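(* There exist absolute constants $C,C_1>0$ such that the following holds for $\delta\in(0,1)$. Suppose the data follow the model and Assumptions 1, 2, 3 of the context, that $n\ge C_1(o+\log(1/\delta)+p)$, and set $$\tau=C\left(\frac{o+\log(1/\delta)}{n}\right)^{2/\ell}.$$ Then, with probability at least $1-\delta$, the two-stage Welsch algorithm described in the context converges to a unique $\hat\beta$, and $$\|\hat\beta-\beta^*\|\le C_1\left(\left(\frac on\right)^{1-1/\ell}\sqrt{\log\left(\frac{en}{2o}\right)}+\sqrt{\frac pn}+\sqrt{\frac{\log(1/\delta)}{n}\log\left(\frac{en}{2\log(1/\delta)}\right)}\right).$$
   Context: Model: for $i=1,\dots,n$, $Y_i=X_i^\top\beta^*+\theta_i+\xi_i$ with $X_i\in\mathbb{R}^p$, $Y_i,\theta_i,\xi_i\in\mathbb{R}$ and unknown $\beta^*\in\mathbb{R}^p$. The $\xi_i$ are independent of the $X_i$. The contamination vector $\theta=(\theta_1,\dots,\theta_n)$ is chosen by an adversary: it is a random vector that may depend arbitrarily on all the $X_i$, $\xi_i$, on $\beta^*$ and on the joint distribution. Assumption 1: $\theta$ is $o$-sparse, i.e. $\sum_{i=1}^n\mathbf{1}(\theta_i\ne0)\le o$. Assumption 2: $X_1,\dots,X_n$ are i.i.d., centered, isotropic ($\mathbf{E}(X_1X_1^\top)=I_p$) and $1$-sub-Gaussian, i.e. $\mathbf{E}\exp(\langle u,X_1\rangle)\le\exp(\|u\|^2/2)$ for all $u\in\mathbb{R}^p$. Assumption 3: $\xi_1,\dots,\xi_n$ are i.i.d.,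 centered, with unit variance, and for some $\ell\ge2$ and $a>0$, $\mathbf{E}(|\xi_1|^\ell)\le a^\ell$; when $\ell=\infty$ this is replaced by $\mathbf{P}(|\xi_1|\ge t)\le 2\exp(-t^2/(2a^2))$ for $t\ge 0$ (and $1/\ell=0$). The number $a$ is bounded by a fixed constant; ''absolute'' constants may depend on that bound but on no other problem parameter. Algorithm. Let $f(\beta)=\frac{1}{\tau n}\sum_{i=1}^n(1-\exp(-\frac\tau2(Y_i-X_i^\top\beta)^2))$ be the empirical Welsch loss and, for a sufficiently small absolute constant $c>0$, $\mathscr{J}_c=\{\beta\in\mathbb{R}^p:\|\beta-\beta^*\|\le c\}$ (the basin of attraction). Stage 1: starting from some $\beta_0$, take steps of an optimization procedure for the least absolute deviation problem $\min_\beta\sum_{i=1}^n|Y_i-X_i^\top\beta|$ until the median of the absolute residuals falls below a threshold; call the result $\beta_{\rm LAD}$; it is taken to be a valid initialization, i.e. to lie in $\mathscr{J}_c$. Stage 2: solve $\min_{\beta}f(\beta)$ by a convex optimization procedure initialized at $\beta_{\rm LAD}$. The output $\hat\beta$ is the solution found in the basin, i.e. a minimizer of $f$ over $\mathscr{J}_c$; ''converges to a unique $\hat\beta$'' means that this minimizer is unique. Conventions: $x\log(\cdot/x)$, and $x^{s}\sqrt{\log(\cdot/x)}$ for $s>0$, are $0$ at $x=0$. $\|\cdot\|$ is the Euclidean norm. *)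

(* Defs.v *)
From HB Require Import structures.
From mathcomp Require Import all_boot all_order all_algebra.
From mathcomp Require Import all_classical all_reals all_analysis.

Set Implicit Arguments.
Unset Strict Implicit.
Unset Printing Implicit Defensive.

Import Order.TTheory GRing.Theory Num.Theory.
Import numFieldNormedType.Exports.

Local Open Scope classical_set_scope.
Local Open Scope ring_scope.

Definition dotc (R : realType) (p : nat) (u v : 'cV[R]_p) : R :=
  \sum_(j < p) u j 0 * v j 0.

(* The library norm `|x| on matrices is the sup norm. *)
Definition enorm (R : realType) (p : nat) (x : 'cV[R]_p) : R :=
  Num.sqrt (dotc x x).

(* Matrices with their Borel sigma-algebra; the library topology on matrices is
   the usual one. *)
Notation borel_mx R m n := (g_sigma_algebraType (@open 'M[R]_(m, n))).

Definition random_mx d (T : measurableType d) (R : realType) (m n : nat)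
    (X : T -> 'M[R]_(m, n)) : Prop :=
  measurable_fun [set: T] (X : T -> borel_mx R m n).

(* Mutual independence of a finite family; the product rule for subfamilies is
   obtained by taking B i = setT. *)
Definition mutually_indep d (T : measurableType d) (R : realType)
    (P : probability T R) d' (E : measurableType d') (I : finType)
    (X : I -> T -> E) : Prop :=
  forall B : I -> set E, (forall i, measurable (B i)) ->
    P [set w | forall i, B i (X i w)] =
    (\prod_(i : I) fine (P [set w | B i (X i w)]))%:E.

Definition identically_distributed d (T : measurableType d) (R : realType)
    (P : probability T R) d' (E : measurableType d') (I : Type)
    (X : I -> T -> E) : Prop :=
  forall (i j : I) (B : set E), measurable B ->
    P [set w | B (X i w)] = P [set w | B (X j w)].

Definition iid d (T : measurableType d) (R : realType)
    (P : probability T R) d' (E : measurableType d') (I : finType)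
    (X : I -> T -> E) : Prop :=
  mutually_indep P X /\ identically_distributed P X.

Definition indep_pair d (T : measurableType d) (R : realType)
    (P : probability T R) d1 (E1 : measurableType d1) d2
    (E2 : measurableType d2) (X : T -> E1) (Y : T -> E2) : Prop :=
  forall (A : set E1) (B : set E2), measurable A -> measurable B ->
    P [set w | A (X w) /\ B (Y w)] =
    (P [set w | A (X w)] * P [set w | B (Y w)])%E.

Definition design_row (R : realType) (n p : nat) (X : 'M[R]_(n, p)) (i : 'I_n)
  : 'cV[R]_p := (row i X)^T.

Definition o_sparse d (T : measurableType d) (R : realType)
    (P : probability T R) (n : nat) (theta : T -> 'cV[R]_n) (o : nat) : Prop :=
  {ae P, forall w, (\sum_(i < n) (theta w i 0%R != 0%R) <= o)%N}.

Definition subgaussian_design d (T : measurableType d) (R : realType)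
    (P : probability T R) (n p : nat) (X : T -> 'M[R]_(n, p)) : Prop :=
  [/\ iid P (fun (i : 'I_n) (w : T) => design_row (X w) i : borel_mx R p 1),
      forall (i : 'I_n) (j : 'I_p), ('E_P[fun w => X w i j] = 0%:E)%E,
      forall (i : 'I_n) (j k : 'I_p),
        ('E_P[fun w => (design_row (X w) i *m (design_row (X w) i)^T)%R j k] =
         ((1%:M : 'M[R]_p)%R j k)%:E)%E
    & forall (i : 'I_n) (u : 'cV[R]_p),
        ('E_P[fun w => expR (dotc u (design_row (X w) i))%R] <=
         (expR (enorm u ^+ 2 / 2))%:E)%E].

Definition noise_assumption d (T : measurableType d) (R : realType)
    (P : probability T R) (n : nat) (xi : T -> 'cV[R]_n) (l : \bar R) (a : R)
    : Prop :=
  [/\ iid P (fun (i : 'I_n) (w : T) => xi w i 0),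
      forall i : 'I_n, ('E_P[fun w => xi w i 0%R] = 0%:E)%E,
      forall i : 'I_n, ('V_P[fun w => xi w i 0%R] = 1%:E)%E
    & forall i : 'I_n,
        match l return Prop with
        | EFin r => ('E_P[fun w => (`|xi w i 0| `^ r)%R] <= (a `^ r)%:E)%E
        | +oo%E => forall t : R, 0 <= t ->
            (P [set w | (t <= `|xi w i 0|)%R] <=
             (2 * expR (- (t ^+ 2) / (2 * a ^+ 2)))%:E)%E
        | -oo%E => False
        end].

(* 1 / l, with 1 / oo = 0. *)
Definition inv_exponent (R : realType) (l : \bar R) : R :=
  if l is EFin r then r^-1 else 0.

Definition response (R : realType) (n p : nat) (X : 'M[R]_(n, p))
    (theta xi : 'cV[R]_n) (bstar : 'cV[R]_p) : 'cV[R]_n :=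
  X *m bstar + theta + xi.

Definition residual (R : realType) (n p : nat) (X : 'M[R]_(n, p))
    (Y : 'cV[R]_n) (b : 'cV[R]_p) (i : 'I_n) : R :=
  Y i 0 - dotc (design_row X i) b.

Definition welsch_loss (R : realType) (n p : nat) (tau : R)
    (X : 'M[R]_(n, p)) (Y : 'cV[R]_n) (b : 'cV[R]_p) : R :=
  (tau * n%:R)^-1 *
  \sum_(i < n) (1 - expR (- (tau / 2) * residual X Y b i ^+ 2)).

Definition basin (R : realType) (p : nat) (bstar : 'cV[R]_p) (c : R)
  : set 'cV[R]_p := [set b | enorm (b - bstar) <= c].

Definition minimizer_over (R : realType) (p : nat) (f : 'cV[R]_p -> R)
    (S : set 'cV[R]_p) (b : 'cV[R]_p) : Prop :=
  S b /\ forall b', S b' -> f b <= f b'.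

(* Midpoint of the two middle order statistics (the middle one for odd sizes). *)
Definition median (R : realType) (s : seq R) : R :=
  let t := sort <=%R s in
  (nth 0 t ((size s).-1)./2 + nth 0 t (size s)./2) / 2.

Definition median_abs_residual (R : realType) (n p : nat) (X : 'M[R]_(n, p))
    (Y : 'cV[R]_n) (b : 'cV[R]_p) : R :=
  median [seq `|residual X Y b i| | i <- enum 'I_n].

(* The iterates it of the optimization procedure for the least absolute
   deviation problem (it 0 being the starting point) are left arbitrary, and are
   stopped the first time the median absolute residual is below h. *)
Definition lad_stage (R : realType) (n p : nat) (X : 'M[R]_(n, p))
    (Y : 'cV[R]_n) (it : nat -> 'cV[R]_p) (h : R) (blad : 'cV[R]_p) : Prop :=
  exists k : nat,
    [/\ blad = it k, median_abs_residual X Y (it k) < h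
      & forall j, (j < k)%N -> h <= median_abs_residual X Y (it j)].

Definition valid_lad_run (R : realType) (n p : nat) (X : 'M[R]_(n, p))
    (Y : 'cV[R]_n) (bstar : 'cV[R]_p) (c : R) (it : nat -> 'cV[R]_p) (h : R)
    : Prop :=
  exists2 blad, lad_stage X Y it h blad & basin bstar c blad.

Definition two_stage_output (R : realType) (n p : nat) (tau : R)
    (X : 'M[R]_(n, p)) (Y : 'cV[R]_n) (bstar : 'cV[R]_p) (c : R)
    (it : nat -> 'cV[R]_p) (h : R) (b : 'cV[R]_p) : Prop :=
  valid_lad_run X Y bstar c it h /\
  minimizer_over (welsch_loss tau X Y) (basin bstar c) b.

(* For 0 <= c valid runs exist (it = fun=> bstar and h large), so this
   entails that bhat is the unique minimizer over the basin. *)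
Definition two_stage_converges (R : realType) (n p : nat) (tau : R)
    (X : 'M[R]_(n, p)) (Y : 'cV[R]_n) (bstar : 'cV[R]_p) (c : R)
    (bhat : 'cV[R]_p) : Prop :=
  forall (it : nat -> 'cV[R]_p) (h : R),
    valid_lad_run X Y bstar c it h ->
    forall b, two_stage_output tau X Y bstar c it h b <-> b = bhat.

Definition welsch_tau (R : realType) (C : R) (n o : nat) (l : \bar R)
    (delta : R) : R :=
  C * ((o%:R + ln (1 / delta)) / n%:R) `^ (2 * inv_exponent l).

(* For o = 0 the first term is 0, since 0 `^ s = 0 for s != 0. *)
Definition welsch_rate (R : realType) (n p o : nat) (l : \bar R) (delta : R)
    : R :=
  (o%:R / n%:R) `^ (1 - inv_exponent l)
    * Num.sqrt (ln (expR 1 * n%:R / (2 * o%:R)))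
  + Num.sqrt (p%:R / n%:R)
  + Num.sqrt (ln (1 / delta) / n%:R
              * ln (expR 1 * n%:R / (2 * ln (1 / delta)))).

(* Inner formulation: G itself need not be measurable. *)
Definition with_prob_ge d (T : measurableType d) (R : realType)
    (P : probability T R) (q : R) (G : set T) : Prop :=
  exists E : set T, [/\ measurable E, E `<=` G & (q%:E <= P E)%E].

(* Main.v *)
Require Import Defs.
From HB Require Import structures.
From mathcomp Require Import all_boot all_order all_algebra.
From mathcomp Require Import all_classical all_reals all_analysis.
From mathcomp Require Import measurable_realfun ring lra.

Set Implicit Arguments.
Unset Strict Implicit.
Unset Printing Implicit Defensive.

Import Order.TTheory GRing.Theory Num.Theory.
Import numFieldNormedType.Exports.

Local Open Scope classical_set_scope.
Local Open Scope ring_scope.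

(** Near [bstar] the Welsch loss is strongly convex.  A row [i] is harmless for a
    pair of points of the basin when it carries no outlier, [tau xi_i^2] is small
    and [tau <X_i, h>^2] is small for both displacements [h]: on it the
    one-dimensional loss is strongly convex between the two residuals, and on
    every row it is semiconvex with an absolute constant.  As [tau] is small, few
    rows are harmful, and few rows of a sub-Gaussian design carry only a small
    share of [sum_i <X_i, u>^2], uniformly in [u].  Hence the minimizer over the
    basin is unique and at distance at most a constant times the norm of the
    gradient at [bstar].

    In that gradient the noise contributes [sum_i psi(xi_i) X_i], which is
    sub-Gaussian conditionally on [xi] with [sum_i psi(xi_i)^2] of order [n].  The
    outliers contribute at most [2 tau^(-1/2)] per contaminated row; by
    Cauchy-Schwarz this costs [sqrt (o / tau)] times the square root of the
    quadratic form restricted to [o] rows, which is of order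
    [o log (n / o) + p + log (1 / delta)].

    Uniformity over sets of rows comes from
    [sum_S q_i^2 <= #|S| t + sum_i (q_i^2 - t)_+], the last sum having exponential
    moments that do not depend on [S]. *)

(** * Independence and exponential moments *)

(** Heavy tails enter only through the truncated squares [Num.min 1 (tau * xi i 0 ^+ 2)]: they are
    bounded, hence have exponential moments, and unit variance bounds their mean by [tau]. As
    [1 / l <= 1 / 2] and [(o + L) / n <= 1] with [L = ln (1 / delta)], one has [C (o + L) <= tau n]
    and [tau <= C]. The first inequality absorbs deviation terms of order [L] into [tau n]. The
    second makes [tau] small through [C] alone, so that any basin of radius at most [1] will do. The
    outlier cost [(o / n) / sqrt tau] is then at most of order [(o / n)^(1 - 1/l)].

    The adversary sees design and noise, so no independence survives on the contaminated rows. The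
    score is therefore summed with the pure noise over all rows, and only the change caused by
    [theta] is charged to the outliers, by bounds uniform in the set of rows. The minimizer may lie
    on the boundary of the basin; uniqueness and the error bound come from comparing values of the
    loss and never from a vanishing gradient. *)

Section integral_comp_mul.
Local Open Scope ereal_scope.
Import HBNNSimple.

(** Linearity and monotone convergence carry the bound from indicators of [X] to [g]. The hypothesis
    on [B] is a one-sided independence of [X] and the weight [W], with [c] a bound on the mean of
    [W]. *)
Lemma integral_comp_mul_le d (T : measurableType d) (R : realType)
    (P : probability T R) d' (E : measurableType d') (X : T -> E)
    (W : T -> R) (c : R) (g : E -> R) :
  measurable_fun setT X -> measurable_fun setT W -> (forall w, 0 <= W w)%R ->
  (forall B, measurable B ->
    \int[P]_w (\1_B (X w) * W w)%:E <= c%:E * P (X @^-1` B)) ->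
  measurable_fun setT g -> (forall x, 0 <= g x)%R -> (0 <= c)%R ->
  \int[P]_w (g (X w) * W w)%:E <= c%:E * \int[P]_w (g (X w))%:E.
Proof.
move=> mX mW W0 H mg g0 c0.
have mg' : measurable_fun setT (EFin \o g) by exact/measurable_EFinP.
pose h := nnsfun_approx measurableT mg'.
have mhX n : measurable_fun setT (h n \o X).
  by apply: measurableT_comp => //.
have step n : \int[P]_w (h n (X w) * W w)%:E <= c%:E * \int[P]_w (h n (X w))%:E.
  have -> : \int[P]_w (h n (X w) * W w)%:E =
     \int[P]_w (\sum_(r \in range (h n))
        ((r * (\1_(h n @^-1` [set r]) (X w) * W w))%:E)).
    apply: eq_integral => w _; rewrite fsumEFin//; congr EFin.
    rewrite [in LHS]fimfunE (fsbig_finite _ _ (fimfunP (h n)))/=.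
    rewrite (fsbig_finite _ _ (fimfunP (h n)))/= big_distrl/=.
    by apply: eq_bigr => r _; rewrite mulrA.
  have -> : \int[P]_w (h n (X w))%:E =
     \int[P]_w (\sum_(r \in range (h n))
        ((r * (\1_(h n @^-1` [set r]) (X w)))%:E)).
    by apply: eq_integral => w _; rewrite fsumEFin//; congr EFin; rewrite fimfunE.
  have mI r : measurable_fun setT (fun w => \1_(h n @^-1` [set r]) (X w) : R).
    by apply: measurableT_comp => //.
  have nn x r : (0 <= r * \1_(h n @^-1` [set r]) x)%R.
    rewrite indicE; case: (boolP (x \in _)) => [|_]; last by rewrite mulr0.
    by rewrite inE/= => <-; rewrite mulr1; exact: fun_ge0.
  rewrite ge0_integral_fsum//; last 2 first.
  - by move=> r; apply/measurable_EFinP; do 2 apply: measurable_funM => //.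
  - by move=> r w _; rewrite lee_fin mulrA mulr_ge0.
  rewrite ge0_integral_fsum//; last 2 first.
  - by move=> r; apply/measurable_EFinP; apply: measurable_funM => //.
  - by move=> r w _; rewrite lee_fin.
  rewrite !(fsbig_finite _ _ (fimfunP (h n)))/= ge0_sume_distrr; last first.
    by move=> r _; apply: integral_ge0 => w _; rewrite lee_fin.
  rewrite big_seq [leRHS]big_seq; apply: lee_sum => r.
  rewrite in_fset_set//= inE => -[x _ hx].
  have r0 : (0 <= r)%R by rewrite -hx; exact: fun_ge0.
  under eq_integral do rewrite EFinM.
  rewrite ge0_integralZl//; [|by apply/measurable_EFinP; apply: measurable_funM|by move=> w
      _; rewrite lee_fin mulr_ge0].
  under [in leRHS]eq_integral do rewrite EFinM.
  rewrite ge0_integralZl//; last by apply/measurable_EFinP.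
  rewrite muleCA lee_wpmul2l//.
  have mB : measurable (h n @^-1` [set r]) by [].
  apply: (le_trans (H _ mB)).
  rewrite (_ : (fun w => (\1_(h n @^-1` [set r]) (X w))%:E) = (EFin \o \1_(X @^-1` (h n
      @^-1` [set r])) )); last first.
    by apply/funext => w /=; rewrite !indicE.
  rewrite integral_indic ?setIT//.
  by rewrite -[X in measurable X]setTI; exact: mX.
have cv w : EFin \o (fun n => h n (X w)) @ \oo --> (g (X w))%:E.
  by apply: (cvg_nnsfun_approx measurableT mg') => //= x _; rewrite lee_fin.
have c1 : (fun n => \int[P]_w (h n (X w) * W w)%:E) @ \oo --> \int[P]_w (g (X w) * W w)%:E.
  have -> : \int[P]_w (g (X w) * W w)%:E = \int[P]_w (limn (fun n => (h n (X w) * W w)%:E)).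
    apply: eq_integral => w _; apply/esym/cvg_lim => //.
    under eq_fun do rewrite EFinM.
    by rewrite EFinM; exact: cvgeZr (cv w).
  apply: cvg_monotone_convergence => //.
  - by move=> n; apply/measurable_EFinP; apply: measurable_funM => //; exact: mhX.
  - by move=> n w _; rewrite lee_fin mulr_ge0//; exact: fun_ge0.
  - move=> w _ m n mn; rewrite lee_fin ler_wpM2r//.
    exact/lefP/nd_nnsfun_approx.
have hle n : \int[P]_w (h n (X w))%:E <= \int[P]_w (g (X w))%:E.
  apply: ge0_le_integral => //.
  - by move=> w _; rewrite lee_fin; exact: fun_ge0.
  - by apply/measurable_EFinP; exact: mhX.
  - by apply/measurable_EFinP; exact: measurableT_comp.
  - move=> w _.
    rewrite -(cvg_lim _ (cv w))//; apply: lime_ge.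
      by apply/cvg_ex; eexists; exact: cv.
    near=> m; rewrite lee_fin.
    have nm : (n <= m)%N by near: m; exists n.
    exact/lefP/nd_nnsfun_approx.
rewrite -(cvg_lim _ c1)//; apply: lime_le.
  by apply/cvg_ex; eexists; exact: c1.
by apply: nearW => n; apply: (le_trans (step n)); rewrite lee_wpmul2l.
Unshelve. all: by end_near. Qed.
End integral_comp_mul.

(** For the factor [k], [integral_comp_mul_le] asks for the same inequality with that factor
    replaced by an indicator. Iterating leaves indicators everywhere, which is the product rule of
    [mutually_indep]. *)
Lemma integral_prod_le d (T : measurableType d) (R : realType)
    (P : probability T R) d' (E : measurableType d') (I : finType)
    (X : I -> T -> E) (g : I -> E -> R) (b : I -> R) :
  mutually_indep P X -> (forall i, measurable_fun setT (X i)) ->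
  (forall i, measurable_fun setT (g i)) -> (forall i x, 0 <= g i x) ->
  (forall i, (\int[P]_w (g i (X i w))%:E <= (b i)%:E)%E) ->
  (\int[P]_w (\prod_i g i (X i w))%:E <= (\prod_i b i)%:E)%E.
Proof.
move=> ind mX mg g0 gb.
(* The list [s] holds the indices whose factor is still arbitrary; outside [s] all factors are
   indicators with their exact probabilities. *)
suff H (s : seq I) : forall (h : I -> E -> R) (c : I -> R),
   (forall i, measurable_fun setT (h i)) -> (forall i x, 0 <= h i x) ->
   (forall i, (\int[P]_w (h i (X i w))%:E <= (c i)%:E)%E) ->
   (forall i, i \notin s -> exists B, [/\ measurable B, h i = \1_B &
      c i = fine (P [set w | B (X i w)])]) ->
   (\int[P]_w (\prod_i h i (X i w))%:E <= (\prod_i c i)%:E)%E.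
  by apply: (H (enum I)) => // i; rewrite mem_enum.
have mXB i B : measurable B -> measurable [set w | B (X i w)].
  by move=> mB; rewrite -[X in measurable X]setTI; exact: mX.
elim: s => [|k s IH] h c mh h0 hc hs.
  have {hs} /choice[B HB] : forall i, exists B, [/\ measurable B, h i = \1_B &
      c i = fine (P [set w | B (X i w)])] by move=> i; exact: hs.
  have mB i : measurable (B i) by have [] := HB i.
  rewrite (eq_bigr (fun i => fine (P [set w | B i (X i w)]))); last first.
    by move=> i _; have [] := HB i.
  rewrite -ind// le_eqVlt; apply/orP; left; apply/eqP.
  rewrite [in RHS](_ : P _ = P ([set w | forall i, B i (X i w)] `&` setT)); last by rewrite setIT.
  rewrite -(integral_indic P measurableT)/=; last first.
    rewrite [X in measurable X](_ : _ = \big[setI/setT]_(i : I) [set w | B i (X i w)]).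
      by apply: bigsetI_measurable => i _; exact: mXB.
    rewrite -bigcap_seq; apply/seteqP; split => w /=; first by move=> H i _; exact: H.
    by move=> H i; apply: H; rewrite /= mem_index_enum.
  apply: eq_integral => w _; congr EFin; rewrite indicE.
  rewrite (eq_bigr (fun i => (X i w \in B i)%:R)); last first.
    by move=> i _; have [_ -> _] := HB i; rewrite indicE.
  have [/set_mem /= H|] := boolP (w \in _).
    by rewrite big1// => i _; rewrite mem_set//; exact: H.
  rewrite notin_setE/= => /existsNP[i Hi].
  by rewrite (bigD1 i)//= (memNset Hi) mul0r.
have c0 i : 0 <= c i.
  rewrite -lee_fin; apply: le_trans (hc i); apply: integral_ge0 => w _.
  by rewrite lee_fin.
pose W w := \prod_(i | i != k) h i (X i w).
pose C := \prod_(i | i != k) c i.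
have -> : (\int[P]_w (\prod_i h i (X i w))%:E = \int[P]_w (h k (X k w) * W w)%:E)%E.
  by apply: eq_integral => w _; rewrite (bigD1 k).
rewrite (bigD1 k)//= mulrC -/C EFinM.
apply: (le_trans (integral_comp_mul_le (W := W) (c := C) _ _ _ _ _ _ _)) => //.
- rewrite /W; under eq_fun do rewrite big_mkcond/=.
  apply: (measurable_prod (h := fun i w => if i != k then h i (X i w) else 1)) => i _.
  by case: (i != k) => //; exact: measurableT_comp.
- by move=> w; apply: prodr_ge0.
- move=> B mB.
  pose h' i := if i == k then \1_B : E -> R else h i.
  pose c' i := if i == k then fine (P [set w | B (X k w)]) else c i.
  have PB : (P (X k @^-1` B) = (fine (P [set w | B (X k w)]))%:E)%E.
    by rewrite fineK// fin_num_measure//; exact: mXB.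
  have := IH h' c'.
  rewrite (bigD1 k)//= /c' eqxx mulrC (eq_bigr c); last by move=> i /negbTE ->.
  rewrite -/C EFinM -PB => IH'.
  have -> : (\int[P]_w (\1_B (X k w) * W w)%:E = \int[P]_w (\prod_i h' i (X i w))%:E)%E.
    apply: eq_integral => w _; rewrite (bigD1 k)//= /h' eqxx; congr (_ * _)%:E.
    by apply: eq_bigr => i /negbTE ->.
  apply: IH'.
  + by move=> i; rewrite /h'; case: ifP => // _; exact: measurable_indic.
  + by move=> i x; rewrite /h'; case: ifP.
  + move=> i; rewrite /h'; case: ifP => [/eqP ->|//].
    rewrite -PB (_ : (fun w => (\1_B (X k w))%:E) = (EFin \o \1_(X k @^-1` B) )); last first.
      by apply/funext => w /=; rewrite !indicE.
    by rewrite integral_indic ?setIT//; exact: mXB.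
  + move=> i si; rewrite /h'; case: ifPn => [/eqP ->|ik]; first by exists B.
    by apply: hs; rewrite inE negb_or ik.
- exact: prodr_ge0.
- by rewrite lee_wpmul2l// lee_fin; exact: prodr_ge0.
Qed.

Lemma integral_expR_sum_le d (T : measurableType d) (R : realType)
    (P : probability T R) d' (E : measurableType d') (I : finType)
    (X : I -> T -> E) (g : I -> E -> R) (b : I -> R) :
  mutually_indep P X -> (forall i, measurable_fun setT (X i)) ->
  (forall i, measurable_fun setT (g i)) ->
  (forall i, (\int[P]_w (expR (g i (X i w)))%:E <= (expR (b i))%:E)%E) ->
  (\int[P]_w (expR (\sum_i g i (X i w)))%:E <= (expR (\sum_i b i))%:E)%E.
Proof.
move=> ind mX mg gb.
under eq_integral do rewrite expR_sum.
rewrite expR_sum; apply: (@integral_prod_le _ _ _ _ _ _ _ _ (fun i x => expR (g i x))) => // i.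
exact: measurableT_comp.
Qed.

(** This plays the role of conditioning on [V]: independence makes the joint law a product, and
    Tonelli freezes the second variable. *)
Lemma indep_pair_integral_le d (T : measurableType d) (R : realType)
    (P : probability T R) d1 (E1 : measurableType d1) d2
    (E2 : measurableType d2) (X : T -> E1) (V : T -> E2)
    (F : E1 * E2 -> R) (c : R) :
  indep_pair P X V -> measurable_fun setT X -> measurable_fun setT V ->
  measurable_fun setT F -> (forall z, 0 <= F z) ->
  (forall y, (\int[P]_w (F (X w, y))%:E <= c%:E)%E) ->
  (\int[P]_w (F (X w, V w))%:E <= c%:E)%E.
Proof.
move=> ind mX mV mF F0 Fc.
pose X' : {mfun T >-> E1} := HB.pack X (isMeasurableFun.Build _ _ _ _ X mX).
pose V' : {mfun T >-> E2} := HB.pack V (isMeasurableFun.Build _ _ _ _ V mV).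
have mXV : measurable_fun setT (fun w => (X w, V w)) by exact: measurable_fun_pair.
pose XV : {mfun T >-> (E1 * E2)%type} := HB.pack (fun w => (X w, V w))
    (isMeasurableFun.Build _ _ _ _ _ mXV).
have mEF : measurable_fun setT (EFin \o F) by exact/measurable_EFinP.
have -> : (\int[P]_w (F (X w, V w))%:E = \int[distribution P XV]_z (F z)%:E)%E.
  by rewrite ge0_integral_distribution// => y; rewrite /= lee_fin.
have -> : (\int[distribution P XV]_z (F z)%:E = \int[distribution P X' \x distribution P
    V']_z (F z)%:E)%E.
  apply: eq_measure_integral => A mA _; apply/esym.
  exact: product_measure_unique.
have F0' z : (0 <= (F z)%:E)%E by rewrite lee_fin.
rewrite (fubini_tonelli2 _ mEF F0') /fubini_G.
have h y : (\int[distribution P X']_x (F (x, y))%:E <= c%:E)%E.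
  rewrite ge0_integral_distribution//.
  - exact: Fc.
  - by apply/measurable_EFinP; exact: measurable_fun_pair1.
apply: (@le_trans _ _ (\int[distribution P V']_y c%:E)%E).
  apply: ge0_le_integral => //.
  - by move=> y _; apply: integral_ge0 => x _; exact: F0'.
  - exact: (measurable_fun_fubini_tonelli_G _ mEF F0').
  - by move=> y _ /=.
by rewrite integral_cst// [X in (_ * X)%E]probability_setT mule1.
Qed.

(* The factor [expR (- k ^+ 2)] makes the sum over [k] a discrete Gaussian
   mixture of the exponentials [expR (k x)]; the term [k = truncn (|x| / 2)]
   already dominates [expR (x ^+ 2 / 4)] up to the constant [e]. *)
Lemma expR_sqr_le_nneseries (R : realType) (x : R) :
  ((expR (x ^+ 2 / 4))%:E <= \sum_(0 <= k <oo)
     (expR 1 * (expR (k%:R * x - k%:R ^+ 2) + expR (- k%:R * x - k%:R ^+ 2)))%:E)%E.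
Proof.
set k := Num.truncn (`|x| / 2).
have x0 : 0 <= `|x| / 2 by rewrite divr_ge0.
have /andP[k1 k2] : k%:R <= `|x| / 2 < k.+1%:R by exact: truncn_itv.
have nn i : 0 <= expR 1 * (expR (i%:R * x - i%:R ^+ 2) + expR (- i%:R * x - i%:R ^+ 2)) :> R.
  by rewrite mulr_ge0// ?addr_ge0// expR_ge0.
apply: le_trans (nneseries_lim_ge k.+1 _); last by move=> i _ _; rewrite lee_fin.
rewrite big_nat_recr//= ; apply: le_trans (leeDr _ _); last first.
  by apply: sume_ge0 => i _; rewrite lee_fin.
rewrite lee_fin; apply: (@le_trans _ _ (expR 1 * expR (k%:R * `|x| - k%:R ^+ 2))).
  (* The exponents differ by [(|x| / 2 - k)^2], which is at most [1] and is paid by the factor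
     [expR 1]. *)
  rewrite -expRD ler_expR.
  rewrite -[k.+1%:R]natr1 in k2.
  have -> : x ^+ 2 = `|x| ^+ 2 by rewrite real_normK// num_real.
  have h1 : 0 <= `|x| / 2 - k%:R by lra.
  have h2 : 0 <= 1 - (`|x| / 2 - k%:R) by lra.
  have := mulr_ge0 h1 h2; nra.
rewrite ler_pM2l ?expR_gt0//.
have [x1|x1] := leP 0 x.
  by rewrite ger0_norm// lerDl expR_ge0.
by rewrite ltr0_norm// mulrN mulNr lerDr expR_ge0.
Qed.

(** Integrated term by term, the mixture leaves [expR (k ^+ 2 / 2 - k ^+ 2) <= z ^+ k], hence a
    geometric series. [K] is fixed before the probability space, as an absolute constant must be. *)
Lemma subgaussian_sqr_mgf (R : realType) : exists2 K : R, 1 <= K &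
  forall d (T : measurableType d) (P : probability T R) (Z : T -> R),
    measurable_fun setT Z ->
    (forall k : R, (\int[P]_w (expR (k * Z w))%:E <= (expR (k ^+ 2 / 2))%:E)%E) ->
    (\int[P]_w (expR (Z w ^+ 2 / 4))%:E <= K%:E)%E.
Proof.
pose z : R := expR (- (1 / 2)).
have z0 : 0 < z by exact: expR_gt0.
have z1 : z < 1 by rewrite expR_lt1; lra.
have e1 : 1 <= expR 1 :> R by have := @expR_ge1Dx R 1; lra.
exists (expR 1 * 2 / (1 - z)).
  rewrite ler_pdivlMr; last lra.
  by rewrite mul1r; lra.
move=> d T P Z mZ HZ.
have mk (k : R) : measurable_fun setT (fun w => expR (k * Z w - k ^+ 2)).
  apply: measurableT_comp => //; apply: measurable_funB => //.
  exact: measurable_funM.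
apply: (@le_trans _ _ (\int[P]_w \sum_(0 <= k <oo)
     (expR 1 * (expR (k%:R * Z w - k%:R ^+ 2) + expR (- k%:R * Z w - k%:R ^+ 2)))%:E)%E).
  apply: ge0_le_integral => //.
  - apply/measurable_EFinP; apply: measurableT_comp => //.
    apply: measurable_funM => //; exact: measurable_funX.
  - apply: (ge0_emeasurable_sum (P := xpredT)) => //.
    move=> k _; apply/measurable_EFinP; apply: measurable_funM => //.
    apply: measurable_funD; first exact: mk.
    by have := mk (- k%:R); under eq_fun do rewrite sqrrN.
  - by move=> w _; exact: expR_sqr_le_nneseries.
rewrite integral_nneseries//; last first.
  - move=> k; apply/measurable_EFinP; apply: measurable_funM => //.
    apply: measurable_funD; first exact: mk.
    by have := mk (- k%:R); under eq_fun do rewrite sqrrN.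
have term (k : nat) : (\int[P]_w (expR 1 * (expR (k%:R * Z w - k%:R ^+ 2) + expR (- k%:R *
    Z w - k%:R ^+ 2)))%:E
    <= (expR 1 * 2 * z ^+ k)%:E)%E.
  have half (r : R) : r ^+ 2 = k%:R ^+ 2 ->
      (\int[P]_w (expR (r * Z w - k%:R ^+ 2))%:E <= (z ^+ k)%:E)%E.
    move=> rk; under eq_integral do rewrite expRD mulrC EFinM.
    rewrite ge0_integralZl//; last first.
      apply/measurable_EFinP; apply: measurableT_comp => //.
      exact: measurable_funM.
    apply: (@le_trans _ _ ((expR (- k%:R ^+ 2))%:E * (expR (r ^+ 2 / 2))%:E)%E).
      by apply: lee_wpmul2l; [rewrite lee_fin expR_ge0|exact: HZ].
    rewrite -EFinM -expRD lee_fin /z -expRM_natl ler_expR rk.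
    have : k%:R <= k%:R ^+ 2 :> R by rewrite -natrX ler_nat; case: (k) => // m; rewrite leq_pmulr.
    by move=> ?; lra.
  under eq_integral do rewrite EFinM.
  rewrite ge0_integralZl//; last first.
    apply/measurable_EFinP; apply: measurable_funD; first exact: mk.
    by have := mk (- k%:R); under eq_fun do rewrite sqrrN.
  rewrite -mulrA EFinM; apply: lee_wpmul2l; first by rewrite lee_fin expR_ge0.
  under eq_integral do rewrite EFinD.
  rewrite ge0_integralD//; last 2 first.
  - apply/measurable_EFinP; exact: mk.
  - by apply/measurable_EFinP; have := mk (- k%:R); under eq_fun do rewrite sqrrN.
  rewrite (_ : 2 * z ^+ k = z ^+ k + z ^+ k); last by ring.
  by rewrite EFinD; apply: leeD; apply: half; rewrite ?sqrrN.
apply: lime_le.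
  apply: ereal_nondecreasing_is_cvgn; apply: ereal_nondecreasing_series => k _ _.
  by apply: integral_ge0 => w _; rewrite lee_fin mulr_ge0// ?addr_ge0// expR_ge0.
apply: nearW => n.
apply: (@le_trans _ _ (\sum_(0 <= k < n) (expR 1 * 2 * z ^+ k)%:E)%E).
  by apply: lee_sum => k _; exact: term.
rewrite sumEFin lee_fin.
apply: (@geometric_le_lim R n (expR 1 * 2) z) => //.
by rewrite ger0_norm ?ltW.
Qed.


Lemma markov_ge0 d (T : measurableType d) (R : realType)
    (P : probability T R) (Z : T -> R) (c a : R) :
  measurable_fun setT Z -> (forall w, 0 <= Z w) ->
  (\int[P]_w (Z w)%:E <= c%:E)%E -> 0 < a ->
  (P [set w | (a <= Z w)%R] <= (c / a)%:E)%E.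
Proof.
move=> mZ Z0 Zc a0.
have mEZ : measurable_fun setT (EFin \o Z) by exact/measurable_EFinP.
have mid : measurable_fun [set: \bar R] id by exact: measurable_id.
have := @le_integral_comp_abse _ _ _ P _ measurableT (EFin \o Z) a id
  mid (fun _ => id) (fun _ _ _ _ => id) mEZ a0.
rewrite setTI (_ : [set x | _] = [set w | a <= Z w]); last first.
  by apply/seteqP; split => w /=; rewrite lee_fin ger0_norm.
rewrite (eq_integral (fun w => (Z w)%:E)); last first.
  by move=> w _ /=; rewrite ger0_norm.
by move=> h; rewrite EFinM lee_pdivlMr// muleC (le_trans h).
Qed.

(* A single Markov inequality, applied to the sum of the exponentials, replaces a
   union bound over [s]. *)
Lemma exp_moment_seq d (T : measurableType d) (R : realType)
    (P : probability T R) (U : eqType) (s : seq U) (f : U -> T -> R) (b M t : R) :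
  (forall u, measurable_fun setT (f u)) ->
  (forall u, u \in s -> (\int[P]_w (expR (f u w))%:E <= (expR b)%:E)%E) ->
  (size s)%:R <= expR M ->
  exists B, [/\ measurable B, (P B <= (expR (- t))%:E)%E &
    forall w, ~ B w -> forall u, u \in s -> f u w <= b + M + t].
Proof.
move=> mf Hf sM.
pose S w := \sum_(u <- s) expR (f u w).
have mS : measurable_fun setT S.
  apply: (measurable_sum s (h := fun u w => expR (f u w))) => u.
  exact: measurableT_comp.
have S0 w : 0 <= S w by apply: sumr_ge0 => u _; exact: expR_ge0.
have IS : (\int[P]_w (S w)%:E <= (expR (b + M))%:E)%E.
  rewrite /S; under eq_integral do rewrite -sumEFin.
  rewrite ge0_integral_sum//; last first.
    by move=> u; apply/measurable_EFinP; exact: measurableT_comp.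
  apply: (@le_trans _ _ (\sum_(u <- s) (expR b)%:E)%E).
    by rewrite big_seq [leRHS]big_seq; apply: lee_sum => u; exact: Hf.
  rewrite sumEFin lee_fin big_const_seq iter_addr_0 count_predT -mulr_natr expRD.
  by rewrite ler_pM2l// expR_gt0.
pose B := [set w | expR (b + M + t) <= S w].
exists B; split.
- rewrite -[X in measurable X]setTI; exact: measurable_fun_ler.
- apply: (le_trans (markov_ge0 mS S0 IS (expR_gt0 _))).
  by rewrite -expRN -expRD lee_fin ler_expR; lra.
- move=> w /negP; rewrite -ltNge => Sw u us; rewrite -ler_expR.
  apply: le_trans (ltW Sw).
  rewrite /S; elim: s us {Hf S mS S0 IS B Sw sM} => //= a s IH; rewrite inE => /orP[/eqP ->|us].
    by rewrite big_cons lerDl sumr_ge0// => i _; exact: expR_ge0.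
  by rewrite big_cons (le_trans (IH us))// lerDr expR_ge0.
Qed.

(** Squaring [1 - w / 2 <= expR (- (w / 2))] reduces the claim to [1 - 3 w + w^2 >= 0], whose
    smaller root [(3 - sqrt 5) / 2] just exceeds [3 / 8]. The range is unbounded below, as the lower
    tail and the semiconvexity require. *)
Lemma expR_le_quadratic (R : realType) (w : R) :
  w <= 3 / 8 -> expR w <= 1 + w + w ^+ 2.
Proof.
move=> w38.
have h1 : 1 - w / 2 <= expR (- (w / 2)) by have := expR_ge1Dx (- (w / 2)); lra.
have h2 : 0 < 1 - w / 2 by lra.
have h3 : (1 - w / 2) ^+ 2 * expR w <= 1.
  have e : 1 = (expR (- (w / 2))) ^+ 2 * expR w.
    by rewrite -expRM_natl -expRD (_ : _ + w = 0) ?expR0//; lra.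
  by rewrite [leRHS]e ler_pM2r ?expR_gt0// ler_sqr ?nnegrE ?expR_ge0 ?(ltW h2).
have h4 : 1 <= (1 - w / 2) ^+ 2 * (1 + w + w ^+ 2).
  have : 0 <= w ^+ 2 * (1 - 3 * w + w ^+ 2).
    by rewrite mulr_ge0 ?sqr_ge0//; have := sqr_ge0 (w - 3 / 8); nra.
  by nra.
have h5 : 0 < (1 - w / 2) ^+ 2 by rewrite exprn_gt0.
by rewrite -(ler_pM2l h5) (le_trans h3).
Qed.

Section square_moments.
Context d (T : measurableType d) (R : realType) (P : probability T R).
Variables (Z : T -> R) (K : R).
Hypotheses (mZ : measurable_fun setT Z)
  (ZK : (\int[P]_w (expR (Z w ^+ 2 / 4))%:E <= K%:E)%E).

Let mZ2 : measurable_fun setT (fun w => expR (Z w ^+ 2 / 4)).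
Proof.
apply: measurableT_comp => //; apply: measurable_funM => //.
exact: measurable_funX.
Qed.

(** Pointwise [expR ((z^2 - t)_+ / 4) <= 1 + expR (- t / 4) expR (z^2 / 4)], so a large threshold
    makes the moment close to [1]. *)
Lemma excess_sqr_mgf (t : R) :
  (\int[P]_w (expR (Num.max (Z w ^+ 2 - t) 0 / 4))%:E
     <= (expR (K * expR (- t / 4)))%:E)%E.
Proof.
apply: (@le_trans _ _ (\int[P]_w (1%:E + (expR (- t / 4))%:E * (expR (Z w ^+ 2 / 4))%:E))%E).
  apply: ge0_le_integral => //.
  - apply/measurable_EFinP; apply: measurableT_comp => //.
    apply: measurable_funM => //; apply: measurable_maxr => //.
    by apply: measurable_funB => //; exact: measurable_funX.
  - by apply/measurable_EFinP; apply: measurable_funD => //; apply: measurable_funM.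
  - move=> w _; rewrite -EFinM -EFinD lee_fin -expRD.
    have [h|h] := leP (Z w ^+ 2 - t) 0.
      by rewrite mul0r expR0 lerDl expR_ge0.
    rewrite (_ : - t / 4 + Z w ^+ 2 / 4 = (Z w ^+ 2 - t) / 4); last by lra.
    by rewrite lerDr.
rewrite ge0_integralD//; last first.
  by apply/measurable_EFinP; apply: measurable_funM.
rewrite integral_cst// [X in (1 * X)%E]probability_setT mule1.
rewrite ge0_integralZl//; last exact/measurable_EFinP.
apply: (@le_trans _ _ (1%:E + (expR (- t / 4))%:E * K%:E)%E).
  by apply: leeD => //; apply: lee_wpmul2l => //; rewrite lee_fin expR_ge0.
by rewrite -EFinM -EFinD lee_fin mulrC expR_ge1Dx.
Qed.

(** The exponent is never positive, so a second-order expansion is valid for every [la]; its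
    quadratic term is controlled by [a^2 <= 32 expR (a / 4)] with [a = Z^2]. *)
Lemma lower_sqr_mgf (s la : R) : 0 <= la ->
  (s%:E <= \int[P]_w (Z w ^+ 2)%:E)%E ->
  (\int[P]_w (expR (- la * Z w ^+ 2))%:E
     <= (expR (- la * s + la ^+ 2 * (32 * K)))%:E)%E.
Proof.
move=> la0 sZ.
have mS : measurable_fun setT (fun w => Z w ^+ 2) by exact: measurable_funX.
have mE : measurable_fun setT (fun w => expR (- la * Z w ^+ 2)).
  by apply: measurableT_comp => //; exact: measurable_funM.
(* The linear term is moved to the left so that only non-negative functions are integrated. *)
have h : (\int[P]_w (expR (- la * Z w ^+ 2))%:E + (la * s)%:E <= (1 + la ^+ 2 * (32 * K))%:E)%E.
  apply: (@le_trans _ _ (\int[P]_w ((expR (- la * Z w ^+ 2))%:E + la%:E * (Z w ^+ 2)%:E))%E).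
    rewrite ge0_integralD//; last 3 first.
    - exact/measurable_EFinP.
    - by move=> w _; rewrite -EFinM lee_fin mulr_ge0// sqr_ge0.
    - by apply/measurable_EFinP; apply: measurable_funM.
    apply: leeD => //; rewrite ge0_integralZl//; last 2 first.
    - exact/measurable_EFinP.
    - by move=> w _; rewrite lee_fin sqr_ge0.
    by rewrite EFinM; apply: lee_wpmul2l.
  apply: (@le_trans _ _ (\int[P]_w (1%:E + (la ^+ 2 * 32)%:E * (expR (Z w ^+ 2 / 4))%:E))%E).
    apply: ge0_le_integral => //.
    - by move=> w _; rewrite -EFinM -EFinD lee_fin addr_ge0 ?expR_ge0// mulr_ge0// sqr_ge0.
    - by apply/measurable_EFinP; apply: measurable_funD => //; apply: measurable_funM.
    - by apply/measurable_EFinP; apply: measurable_funD => //; apply: measurable_funM.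
    - move=> w _; rewrite -!EFinM -!EFinD lee_fin.
      set a := Z w ^+ 2.
      have a0 : 0 <= a by exact: sqr_ge0.
      have a4 : 0 <= a / 4 by lra.
      have la1 : 0 <= la * a by exact: mulr_ge0.
      have q : expR (- la * a) <= 1 + (- la * a) + (- la * a) ^+ 2.
        by apply: expR_le_quadratic; lra.
      have := @expR_ge1Dxn R _ 1%N a4; rewrite (_ : 2`! = 2)%N// => q2.
      have q3 : la ^+ 2 * a ^+ 2 <= la ^+ 2 * (32 * expR (a / 4)).
        by apply: ler_wpM2l; [exact: sqr_ge0|lra].
      nra.
  rewrite ge0_integralD//; last 2 first.
  - by move=> w _; rewrite -EFinM lee_fin mulr_ge0 ?expR_ge0// mulr_ge0// sqr_ge0.
  - by apply/measurable_EFinP; apply: measurable_funM.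
  rewrite integral_cst// [X in (1 * X)%E]probability_setT mule1.
  rewrite ge0_integralZl//; last 2 first.
  - exact/measurable_EFinP.
  - by rewrite lee_fin mulr_ge0// sqr_ge0.
  rewrite EFinD mulrA; apply: leeD => //; rewrite [leRHS]EFinM; apply: lee_wpmul2l => //.
  by rewrite lee_fin mulr_ge0// sqr_ge0.
move: h; rewrite -leeBrDr// => /le_trans; apply.
by rewrite -EFinB lee_fin (le_trans _ (expR_ge1Dx _))//; lra.
Qed.

End square_moments.

(** * Nets of the Euclidean ball *)

Section euclidean.
Context (R : realType) (p : nat).
Implicit Types u v w : 'cV[R]_p.

Lemma dotcC u v : dotc u v = dotc v u.
Proof. by apply: eq_bigr => j _; rewrite mulrC. Qed.

Lemma dotcDl u v w : dotc (u + v) w = dotc u w + dotc v w.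
Proof. by rewrite /dotc -big_split; apply: eq_bigr => j _; rewrite mxE mulrDl. Qed.

Lemma dotcZl (a : R) u v : dotc (a *: u) v = a * dotc u v.
Proof. by rewrite /dotc big_distrr/=; apply: eq_bigr => j _; rewrite mxE mulrA. Qed.

Lemma dotcDr u v w : dotc u (v + w) = dotc u v + dotc u w.
Proof. by rewrite dotcC dotcDl !(dotcC u). Qed.

Lemma dotcZr (a : R) u v : dotc u (a *: v) = a * dotc u v.
Proof. by rewrite dotcC dotcZl dotcC. Qed.

Lemma dotcNr u v : dotc u (- v) = - dotc u v.
Proof. by rewrite -scaleN1r dotcZr mulN1r. Qed.

Lemma dotcBr u v w : dotc u (v - w) = dotc u v - dotc u w.
Proof. by rewrite dotcDr dotcNr. Qed.

Lemma dotc_ge0 u : 0 <= dotc u u.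
Proof. by apply: sumr_ge0 => j _; rewrite -expr2 sqr_ge0. Qed.

Lemma enorm_ge0 u : 0 <= enorm u.
Proof. exact: sqrtr_ge0. Qed.

Lemma enorm_sqr u : enorm u ^+ 2 = dotc u u.
Proof. by rewrite sqr_sqrtr// dotc_ge0. Qed.

Lemma enorm_eq0 u : enorm u = 0 -> u = 0.
Proof.
move=> u0; have : dotc u u = 0 by rewrite -enorm_sqr u0 expr0n.
move/eqP; rewrite psumr_eq0; last by move=> j _; rewrite -expr2 sqr_ge0.
move=> /allP h; apply/matrixP => j k; rewrite ord1 mxE.
by have := h j; rewrite mem_index_enum => /(_ isT) /=; rewrite mulf_eq0 orbb => /eqP.
Qed.

Lemma enorm0 : enorm (0 : 'cV[R]_p) = 0.
Proof. by rewrite /enorm /dotc big1 ?sqrtr0// => j _; rewrite mxE mul0r. Qed.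

Lemma enormZ (a : R) u : enorm (a *: u) = `|a| * enorm u.
Proof.
by rewrite /enorm dotcZl dotcZr mulrA -expr2 sqrtrM ?sqr_ge0// sqrtr_sqr.
Qed.

Lemma enormN u : enorm (- u) = enorm u.
Proof. by rewrite -scaleN1r enormZ normrN normr1 mul1r. Qed.

Lemma cauchy_schwarz u v : dotc u v <= enorm u * enorm v.
Proof.
have [/eqP/enorm_eq0 ->|u0] := boolP (enorm u == 0).
  by rewrite /dotc big1 ?mulr_ge0 ?enorm_ge0// => j _; rewrite mxE mul0r.
have [/eqP/enorm_eq0 ->|v0] := boolP (enorm v == 0).
  by rewrite /dotc big1 ?mulr_ge0 ?enorm_ge0// => j _; rewrite mxE mulr0.
have up : 0 < enorm u by rewrite lt_def u0 enorm_ge0.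
have vp : 0 < enorm v by rewrite lt_def v0 enorm_ge0.
have := dotc_ge0 (enorm v *: u - enorm u *: v).
rewrite dotcBr !(dotcC (_ - _)) !dotcBr !dotcZl !dotcZr -!enorm_sqr (dotcC v u).
move: (dotc u v) (enorm u) (enorm v) up vp => x a b a0 b0 h.
have : 0 <= (2 * a * b) * (a * b - x) by move: h; nra.
by rewrite pmulr_rge0 ?subr_ge0// !mulr_gt0.
Qed.

Lemma enormD u v : enorm (u + v) <= enorm u + enorm v.
Proof.
rewrite -ler_sqr ?nnegrE ?addr_ge0 ?enorm_ge0//.
rewrite enorm_sqr dotcDl !dotcDr (dotcC v u) -!enorm_sqr.
by have := cauchy_schwarz u v; nra.
Qed.

Lemma enormB u v : enorm (u - v) = enorm (v - u).
Proof. by rewrite -enormN opprB. Qed.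

Lemma coord_le_enorm u j : `|u j 0| <= enorm u.
Proof.
rewrite -sqrtr_sqr ler_sqrt ?dotc_ge0// /dotc (bigD1 j)//= -expr2 lerDl.
by apply: sumr_ge0 => k _; rewrite -expr2 sqr_ge0.
Qed.

End euclidean.

Lemma sumr_half_pow (R : realType) N : \sum_(k < N) (1 / 2 : R) ^+ k <= 2.
Proof.
have : \sum_(k < N) (1 / 2 : R) ^+ k = 2 - 2 * (1 / 2) ^+ N.
  elim: N => [|N IH]; first by rewrite big_ord0; lra.
  by rewrite big_ord_recr/= IH exprS; lra.
by move=> ->; rewrite gerBl mulr_ge0// exprn_ge0//; lra.
Qed.

(* The net is the part of a cubic lattice of step [1 / (q sqrt p)] inside the
   ball, points being rounded towards the origin; its cardinality is estimated
   by weighting the point [z] with [2 ^ - sum |z_j|]. *)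
Lemma ball_net (R : realType) (q p : nat) : (0 < q)%N ->
  exists s : seq 'cV[R]_p,
    [/\ (size s)%:R <= expR ((q%:R ^+ 2 + 2) * p%:R) :> R,
        forall v, v \in s -> enorm v <= 1 &
        forall u, enorm u <= 1 -> exists2 v, v \in s & enorm (u - v) <= q%:R^-1].
Proof.
move=> q0; case: (posnP p) => [->|p0].
  exists [:: 0]; split => [|v|u _]; first by rewrite mulr0 expR0.
    by rewrite inE => /eqP ->; rewrite enorm0.
  exists 0; rewrite ?inE//.
  by rewrite (_ : u - 0 = 0) ?enorm0 ?invr_ge0//; apply/matrixP => -[].
have q0' : (0 : R) < q%:R by rewrite ltr0n.
have p0' : (0 : R) < p%:R by rewrite ltr0n.
pose h : R := (q%:R * Num.sqrt p%:R)^-1.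
have sp0 : 0 < Num.sqrt p%:R :> R by rewrite sqrtr_gt0.
have h0 : 0 < h by rewrite invr_gt0 mulr_gt0.
have h2 : h ^+ 2 * (p * q ^ 2)%:R = 1.
  rewrite /h exprVn exprMn sqr_sqrtr ?ltW// natrM natrX mulrC [p%:R * _]mulrC.
  by rewrite divff// mulf_neq0 ?gt_eqF// exprn_gt0.
pose N := (p * q ^ 2).+1.
pose zT := {ffun 'I_p -> bool * 'I_N}.
pose vz (z : zT) : 'cV[R]_p := \col_j (h * ((-1) ^+ (z j).1 * ((z j).2)%:R)).
pose good (z : zT) := (\sum_j (z j).2 ^ 2 <= p * q ^ 2)%N.
have nvz z : enorm (vz z) ^+ 2 = h ^+ 2 * (\sum_j (z j).2 ^ 2)%:R.
  rewrite enorm_sqr /dotc natr_sum big_distrr; apply: eq_bigr => j _.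
  rewrite mxE natrX -expr2 !exprMn; congr (_ * _).
  by rewrite -exprM mulnC exprM sqrrN expr1n expr1n mul1r.
exists [seq vz z | z <- enum good]; split.
- rewrite size_map -cardE -sum1_card natr_sum.
  (* A good point has [sum |z_j| <= sum z_j^2 <= p q^2], so its weight times [2 ^ (p q^2)] is at
     least [1]. *)
  apply: (@le_trans _ _ (\sum_(z : zT) 2 ^+ (p * q ^ 2) * \prod_j (1 / 2 : R) ^+ (z j).2)).
    rewrite big_mkcond; apply: ler_sum => z _.
    have nn : 0 <= \prod_j (1 / 2 : R) ^+ (z j).2.
      by apply: prodr_ge0 => j _; rewrite exprn_ge0//; lra.
    case: ifPn => [zg|_]; last by rewrite mulr_ge0// exprn_ge0.
    rewrite prodrXr -ler_pdivrMr; last by rewrite exprn_gt0//; lra.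
    rewrite !div1r -exprVn invrK.
    rewrite ler_eXn2l; last by lra.
    apply: leq_trans zg; apply: leq_sum => j _.
    by case: (nat_of_ord _) => // m; rewrite leq_pmulr.
  rewrite -big_distrr /= -(bigA_distr_bigA (fun (j : 'I_p) (bk : bool * 'I_N) => (1 / 2 :
      R) ^+ bk.2)).
  have e2 : (2 : R) <= expR 1 by have := @expR_ge1Dx R 1; lra.
  rewrite mulrDl expRD; apply: ler_pM.
  + by rewrite exprn_ge0.
  + by apply: prodr_ge0 => j _; apply: sumr_ge0 => k _; rewrite exprn_ge0//; lra.
  + rewrite (_ : _ * _ = 1 * (p * q ^ 2)%:R); last by rewrite natrM natrX mul1r mulrC.
    by rewrite expRM_natr lerXn2r// nnegrE// expR_ge0.
  + rewrite expRM_natr -[in leRHS](card_ord p) -prodr_const; apply: ler_prod => j _.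
    apply/andP; split; first by apply: sumr_ge0 => k _; rewrite exprn_ge0//; lra.
    rewrite -(pair_bigA _ (fun (b : bool) (k : 'I_N) => (1 / 2 : R) ^+ k))/=.
    rewrite big_bool/=; have := sumr_half_pow R N => hN.
    (* Two signs and a geometric sum of at most [2] give [4 <= expR 2] per coordinate. *)
    apply: (@le_trans _ _ 4); first by lra.
    rewrite (_ : 2 = 1 + 1 :> R)// expRD; nra.
- move=> v /mapP[z]; rewrite mem_enum => zg ->.
  rewrite -(@ler_pXn2r _ 2)// ?nnegrE ?enorm_ge0// expr1n nvz -[leRHS]h2.
  by rewrite ler_pM2l ?exprn_gt0// ler_nat.
- move=> u u1.
  pose k j := Num.truncn (`|u j 0| / h).
  have kt j : (k j)%:R <= `|u j 0| / h < (k j).+1%:R.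
    by apply: truncn_itv; rewrite divr_ge0// ltW.
  have ksum : (\sum_j k j ^ 2 <= p * q ^ 2)%N.
    rewrite -(@ler_nat R) -(@ler_pM2l _ (h ^+ 2)) ?exprn_gt0// h2.
    apply: (@le_trans _ _ (enorm u ^+ 2)); last by rewrite expr_le1// enorm_ge0.
    rewrite enorm_sqr natr_sum big_distrr; apply: ler_sum => j _ /=.
    rewrite natrX -exprMn -expr2 -[leRHS]real_normK ?num_real//.
    apply: lerXn2r; rewrite ?nnegrE ?normr_ge0 ?mulr_ge0 ?(ltW h0)//.
    by rewrite mulrC -ler_pdivlMr//; case/andP: (kt j).
  have kN j : (k j < N)%N.
    rewrite ltnS; apply: leq_trans ksum; rewrite (bigD1 j)//=.
    by apply: leq_trans (leq_addr _ _); case: (k j) => // m; rewrite leq_pmulr.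
  pose z : zT := [ffun j => (u j 0 < 0, Ordinal (kN j))].
  have zg : good z by rewrite /good; under eq_bigr do rewrite ffunE.
  exists (vz z); first by apply: map_f; rewrite mem_enum.
  rewrite -(@ler_pXn2r _ 2)// ?nnegrE ?enorm_ge0 ?invr_ge0//.
  rewrite enorm_sqr.
  apply: (@le_trans _ _ (\sum_(j < p) h ^+ 2)).
    apply: ler_sum => j _; rewrite -expr2 -real_normK ?num_real//.
    apply: lerXn2r; rewrite ?nnegrE ?normr_ge0 ?(ltW h0)//.
    rewrite !mxE ffunE/=.
    have /andP[] := kt j; rewrite ler_pdivlMr// ltr_pdivrMr// -natr1 mulrDl mul1r => k1 k2.
    have [uj|uj] := ltP (u j 0) 0.
      rewrite ltr0_norm// in k1 k2; rewrite expr1 ler_norml; apply/andP; split; nra.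
    rewrite ger0_norm// in k1 k2; rewrite expr0 ler_norml; apply/andP; split; nra.
  rewrite sumr_const card_ord -[_ *+ p]mulr_natr.
  have -> : (q%:R^-1 : R) ^+ 2 = h ^+ 2 * (p * q ^ 2)%:R * q%:R^-1 ^+ 2 by rewrite h2 mul1r.
  by rewrite natrM natrX -[leRHS]mulrA -[_ * _ * q%:R^-1 ^+ 2]mulrA -exprMn divff ?expr1n
      ?mulr1 ?gt_eqF.
Qed.

Definition covers_ball (R : realType) (p : nat) (e : R) (s : seq 'cV[R]_p) :=
  forall u, enorm u <= 1 -> exists2 v, v \in s & enorm (u - v) <= e.

Section nets.
Context (R : realType) (p : nat) (s : seq 'cV[R]_p).

(** Testing [w] on the net point nearest to its direction loses at most half of the norm. *)
Lemma net_dual (w : 'cV[R]_p) (m : R) : covers_ball (1 / 2) s ->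
  (forall v, v \in s -> dotc w v <= m) -> enorm w <= 2 * m.
Proof.
move=> cs sm; have [w0|w0] := eqVneq (enorm w) 0.
  have [v vs] : exists2 v, v \in s & enorm (0 - v) <= 1 / 2.
    by apply: cs; rewrite enorm0.
  have := sm v vs; rewrite w0 (enorm_eq0 w0) /dotc big1; last by move=> j _; rewrite mxE mul0r.
  by move=> ? _; lra.
have wp : 0 < enorm w by rewrite lt_def w0 enorm_ge0.
have [v vs uv] : exists2 v, v \in s & enorm ((enorm w)^-1 *: w - v) <= 1 / 2.
  by apply: cs; rewrite enormZ ger0_norm ?invr_ge0 ?enorm_ge0// mulVf.
have : enorm w = dotc w ((enorm w)^-1 *: w - v) + dotc w v.
  by rewrite -dotcDr subrK dotcZr -enorm_sqr expr2 mulKf.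
have := sm v vs; have := cauchy_schwarz w ((enorm w)^-1 *: w - v).
by have := ler_wpM2l (ltW wp) uv; lra.
Qed.

Context (n : nat) (A : 'M[R]_(n, p)).

(** Only the finiteness of the operator norm matters: it lets [net_opnorm] absorb the supremum into
    itself. *)
Lemma mulmx_bounded : exists2 B, 0 <= B & forall u, enorm (A *m u) <= B * enorm u.
Proof.
exists (Num.sqrt (\sum_(i < n) enorm (design_row A i) ^+ 2)) => [|u].
  exact: sqrtr_ge0.
have S0 : 0 <= \sum_(i < n) enorm (design_row A i) ^+ 2.
  by apply: sumr_ge0 => i _; exact: sqr_ge0.
rewrite -(@ler_pXn2r _ 2)// ?nnegrE ?mulr_ge0 ?sqrtr_ge0 ?enorm_ge0//.
rewrite enorm_sqr exprMn sqr_sqrtr// big_distrl; apply: ler_sum => i _ /=.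
have -> : (A *m u) i 0 = dotc (design_row A i) u.
  by rewrite mxE; apply: eq_bigr => j _; rewrite !mxE.
have h := cauchy_schwarz (design_row A i) u.
have h' := cauchy_schwarz (design_row A i) (- u).
rewrite dotcNr enormN in h'.
by rewrite -exprMn -expr2 -(real_normK (num_real (dotc _ _))) lerXn2r ?nnegrE ?mulr_ge0
    ?enorm_ge0// ler_norml; lra.
Qed.

Lemma net_opnorm (e M : R) : covers_ball e s -> e <= 1 / 2 ->
  (forall v, v \in s -> enorm (A *m v) <= M) ->
  forall u, enorm (A *m u) <= 2 * M * enorm u.
Proof.
move=> cs e2 sM.
have [B B0 AB] := mulmx_bounded.
pose V := [set enorm (A *m u) | u in [set u | enorm u <= 1]].
have Vub : has_ubound V.
  exists B => _ [u /= u1 <-]; apply: le_trans (AB u) _.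
  by rewrite -[leRHS]mulr1 ler_wpM2l.
have V0 : V !=set0 by exists (enorm (A *m 0)); exists 0 => //=; rewrite enorm0.
have Vle u : enorm (A *m u) <= sup V * enorm u.
  have [/enorm_eq0 ->|u0] := eqVneq (enorm u) 0; first by rewrite mulmx0 !enorm0 mulr0.
  have up : 0 < enorm u by rewrite lt_def u0 enorm_ge0.
  rewrite -ler_pdivrMr//; apply: ub_le_sup => //.
  exists ((enorm u)^-1 *: u) => /=.
    by rewrite enormZ ger0_norm ?invr_ge0 ?enorm_ge0// mulVf.
  by rewrite -scalemxAr enormZ ger0_norm ?invr_ge0 ?enorm_ge0// mulrC.
(* Each [u] is a net point plus a remainder of norm at most [1 / 2], on which the supremum itself is
   used. *)
have : sup V <= M + sup V / 2.
  apply: ge_sup => // _ [u /= u1 <-].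
  have [v vs uv] := cs u u1.
  rewrite (_ : A *m u = A *m v + A *m (u - v)); last by rewrite -mulmxDr addrC subrK.
  apply: le_trans (enormD _ _) _; apply: lerD; first exact: sM.
  apply: le_trans (Vle _) _; apply: ler_wpM2l; last by lra.
  apply: le_trans (ub_le_sup Vub _); last by exists 0 => //=; rewrite enorm0.
  exact: enorm_ge0.
move=> h u; apply: le_trans (Vle u) _; apply: ler_wpM2r; first exact: enorm_ge0.
lra.
Qed.

(** A net point close to a unit vector has norm at least [1 - e >= 1 / 2], so the lower bound is
    asked only away from the origin. *)
Lemma net_lower (e a b : R) : covers_ball e s -> e <= 1 / 2 ->
  0 <= a -> 0 <= b ->
  (forall v, v \in s -> 1 / 2 <= enorm v -> a * enorm v <= enorm (A *m v)) ->
  (forall u, enorm (A *m u) <= b * enorm u) ->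
  forall u, (a * (1 - e) - b * e) * enorm u <= enorm (A *m u).
Proof.
move=> cs e2 a0 b0 sa Ab u.
have [u0|u0] := eqVneq (enorm u) 0; first by rewrite u0 mulr0 enorm_ge0.
have up : 0 < enorm u by rewrite lt_def u0 enorm_ge0.
rewrite -ler_pdivlMr//; set u' := (enorm u)^-1 *: u.
have u'1 : enorm u' = 1 by rewrite enormZ ger0_norm ?invr_ge0 ?enorm_ge0// mulVf.
have -> : enorm (A *m u) / enorm u = enorm (A *m u').
  by rewrite -scalemxAr enormZ ger0_norm ?invr_ge0 ?enorm_ge0// mulrC.
have [v vs uv] : exists2 v, v \in s & enorm (u' - v) <= e by apply: cs; rewrite u'1.
have v1 : 1 - e <= enorm v.
  by have := enormD v (u' - v); rewrite addrC subrK u'1; lra.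
have v2 : 1 / 2 <= enorm v by lra.
have := sa v vs v2.
have : enorm (A *m v) <= enorm (A *m u') + b * e.
  rewrite (_ : A *m v = A *m u' + A *m (v - u')); last by rewrite -mulmxDr addrC subrK.
  apply: le_trans (enormD _ _) _; apply: lerD => //; apply: le_trans (Ab _) _.
  by apply: ler_wpM2l => //; rewrite enormB.
by have := ler_wpM2l a0 v1; lra.
Qed.

End nets.

(** * Convexity of the Welsch loss *)

Lemma expRN_sqr_le (R : realType) (x : R) : x ^+ 2 * expR (- (x ^+ 2 / 2)) <= 2.
Proof.
rewrite expRN -ler_pdivlMr ?invr_gt0 ?expR_gt0// invrK.
have := expR_ge1Dx (x ^+ 2 / 2); have := sqr_ge0 x; lra.
Qed.

(** With [w = (y^2 - x^2) / 2], one has [w - x (y - x) = (y - x)^2 / 2], and [|x + y| <= 1] gives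
    [w^2 <= (y - x)^2 / 4]. Half of the quadratic term survives, times a density of at least
    [7 / 8]; and [7 / 32 >= 1 / 5]. *)
Lemma gauss_local_convexity (R : realType) (x y : R) :
  x ^+ 2 <= 1 / 4 -> y ^+ 2 <= 1 / 4 ->
  x * expR (- (x ^+ 2 / 2)) * (y - x) + (y - x) ^+ 2 / 5
    <= expR (- (x ^+ 2 / 2)) - expR (- (y ^+ 2 / 2)).
Proof.
move=> x4 y4.
pose w := (y ^+ 2 - x ^+ 2) / 2.
have -> : expR (- (y ^+ 2 / 2)) = expR (- (x ^+ 2 / 2)) * expR (- w).
  by rewrite -expRD; congr expR; rewrite /w; lra.
have hw : expR (- w) <= 1 + - w + (- w) ^+ 2.
  by apply: expR_le_quadratic; rewrite /w; have := sqr_ge0 y; lra.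
have E1 : 7 / 8 <= expR (- (x ^+ 2 / 2)) by have := expR_ge1Dx (- (x ^+ 2 / 2)); lra.
have E0 := expR_ge0 (- (x ^+ 2 / 2)).
have := ler_wpM2l E0 hw.
move: (expR (- (x ^+ 2 / 2))) (expR (- w)) E1 E0 => E F E1 E0 EF.
have xy : (x + y) ^+ 2 <= 1 by have := sqr_ge0 (x - y); nra.
have w2 : w ^+ 2 <= (y - x) ^+ 2 / 4.
  rewrite (_ : w ^+ 2 = (y - x) ^+ 2 / 4 * (x + y) ^+ 2); last by rewrite /w; field.
  by have := sqr_ge0 (y - x); nra.
have h1 : E * (w - x * (y - x) - w ^+ 2) >= E * ((y - x) ^+ 2 / 4).
  by apply: ler_wpM2l => //; rewrite (_ : w - x * (y - x) = (y - x) ^+ 2 / 2); [lra|rewrite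
      /w; field].
have h2 : 7 / 8 * ((y - x) ^+ 2 / 4) <= E * ((y - x) ^+ 2 / 4).
  by apply: ler_wpM2r => //; have := sqr_ge0 (y - x); lra.
have h3 := sqr_ge0 (y - x).
rewrite sqrrN in EF; lra.
Qed.

(** For [- x d <= 3 / 8] the quadratic bound on the exponential applies. Beyond that the linear term
    is non-positive, and it is enough that [expR (- (y^2 / 2)) <= 50 d^2]. *)
Lemma gauss_semiconvexity (R : realType) (x y : R) :
  x * expR (- (x ^+ 2 / 2)) * (y - x) - 50 * (y - x) ^+ 2
    <= expR (- (x ^+ 2 / 2)) - expR (- (y ^+ 2 / 2)).
Proof.
pose d := y - x.
have -> : y - x = d by [].
have yE : y = x + d by rewrite /d; lra.
have E0 := expR_ge0 (- (x ^+ 2 / 2)).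
have Ex := expRN_sqr_le x.
have d0 := sqr_ge0 d.
have [xd|xd] := leP (- (x * d)) (3 / 8).
  have -> : expR (- (y ^+ 2 / 2)) = expR (- (x ^+ 2 / 2)) * expR (- (x * d) - d ^+ 2 / 2).
    by rewrite -expRD yE; congr expR; field.
  have hw : expR (- (x * d) - d ^+ 2 / 2) <= 1 + - (x * d) + (- (x * d)) ^+ 2.
    by apply: le_trans (expR_le_quadratic xd); rewrite ler_expR; lra.
  have := ler_wpM2l E0 hw; have := ler_wpM2r d0 Ex.
  by rewrite sqrrN exprMn; nra.
have xdE : 0 <= - (x * d) * expR (- (x ^+ 2 / 2)) by rewrite mulr_ge0//; lra.
suff : expR (- (y ^+ 2 / 2)) <= 50 * d ^+ 2 by lra.
have [d1|d1] := leP (9 / 64) (d ^+ 2).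
  have : expR (- (y ^+ 2 / 2)) <= 1 by rewrite expR_le1; have := sqr_ge0 y; lra.
  lra.
have xd2 : 9 / 64 < x ^+ 2 * d ^+ 2 by rewrite -exprMn; nra.
have x1 : 1 < x ^+ 2 by have := sqr_ge0 x; nra.
(* Here [|d| < 3 / 8 < 3 |x| / 8], so [|y| >= 5 |x| / 8] and the decay at [y] is comparable to that
   at [x]. *)
have y2 : 25 / 64 * x ^+ 2 <= y ^+ 2.
  have dl : - (3 / 8) < d by nra.
  have dr : d < 3 / 8 by nra.
  have [x0|x0] := leP 0 x.
    have x1' : 1 < x by nra.
    by rewrite yE; nra.
  have x1' : x < -1 by nra.
  by rewrite yE; nra.
have y0 : 0 < y ^+ 2 by lra.
rewrite -(ler_pM2l y0) (le_trans (expRN_sqr_le y))//; nra.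
Qed.

(** The derivative in [r] of [(1 - expR (- (tau / 2) * r ^+ 2)) / tau]. *)
Definition welsch_score (R : realType) (tau r : R) : R :=
  r * expR (- (tau / 2) * r ^+ 2).

Lemma welsch_local_convexity (R : realType) (tau x y : R) : 0 < tau ->
  tau * x ^+ 2 <= 1 / 4 -> tau * y ^+ 2 <= 1 / 4 ->
  tau * (welsch_score tau x * (y - x) + (y - x) ^+ 2 / 5)
    <= expR (- (tau / 2) * x ^+ 2) - expR (- (tau / 2) * y ^+ 2).
Proof.
(* Rescaling both residuals by [s] reduces the claim to the standard Gaussian profile. *)
move=> t0; have {t0} [s ->] : exists s, tau = s ^+ 2.
  by exists (Num.sqrt tau); rewrite sqr_sqrtr ?ltW.
move=> hx hy; have := @gauss_local_convexity R (s * x) (s * y).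
rewrite -mulrBr !exprMn => /(_ hx hy).
rewrite (_ : - (s ^+ 2 * x ^+ 2 / 2) = - (s ^+ 2 / 2) * x ^+ 2); last by field.
rewrite (_ : - (s ^+ 2 * y ^+ 2 / 2) = - (s ^+ 2 / 2) * y ^+ 2); last by field.
apply: le_trans; rewrite /welsch_score le_eqVlt; apply/orP; left; apply/eqP.
by field.
Qed.

Lemma welsch_semiconvexity (R : realType) (tau x y : R) : 0 < tau ->
  tau * (welsch_score tau x * (y - x) - 50 * (y - x) ^+ 2)
    <= expR (- (tau / 2) * x ^+ 2) - expR (- (tau / 2) * y ^+ 2).
Proof.
move=> t0; have {t0} [s ->] : exists s, tau = s ^+ 2.
  by exists (Num.sqrt tau); rewrite sqr_sqrtr ?ltW.
have := @gauss_semiconvexity R (s * x) (s * y).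
rewrite -mulrBr !exprMn.
rewrite (_ : - (s ^+ 2 * x ^+ 2 / 2) = - (s ^+ 2 / 2) * x ^+ 2); last by field.
rewrite (_ : - (s ^+ 2 * y ^+ 2 / 2) = - (s ^+ 2 / 2) * y ^+ 2); last by field.
apply: le_trans; rewrite /welsch_score le_eqVlt; apply/orP; left; apply/eqP.
by ring.
Qed.

(** With [a = tau r^2] the left side is [a expR (- a)]. The bound [1] serves the outliers, the
    minimum serves the energy of the noise score. *)
Lemma sqr_welsch_score_le (R : realType) (tau r : R) : 0 < tau ->
  tau * welsch_score tau r ^+ 2 <= Num.min 1 (tau * r ^+ 2).
Proof.
move=> t0; rewrite /welsch_score exprMn -expRM_natl.
set a := tau * r ^+ 2.
have a0 : 0 <= a by rewrite mulr_ge0 ?sqr_ge0// ltW.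
rewrite mulrA -/a (_ : 2%:R * (- (tau / 2) * r ^+ 2) = - a); last by rewrite /a; field.
rewrite le_min; apply/andP; split.
  rewrite expRN -ler_pdivlMr ?invr_gt0 ?expR_gt0// invrK mul1r.
  by have := expR_ge1Dx a; lra.
by rewrite -[leRHS]mulr1 ler_wpM2l// expR_le1; lra.
Qed.

Lemma residualE (R : realType) (n p : nat) (X : 'M[R]_(n, p))
    (theta xi : 'cV[R]_n) (bstar b : 'cV[R]_p) (i : 'I_n) :
  residual X (response X theta xi bstar) b i =
  theta i 0 + xi i 0 - dotc (design_row X i) (b - bstar).
Proof.
rewrite /residual /response dotcBr !mxE.
have -> : \sum_j X i j * bstar j 0 = dotc (design_row X i) bstar.
  by apply: eq_bigr => j _; rewrite !mxE.
by ring.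
Qed.

Section deterministic.
Context (R : realType) (n p : nat) (X : 'M[R]_(n, p)) (theta xi : 'cV[R]_n).
Variables (bstar : 'cV[R]_p) (tau c kappa kappa' K2 m : R).
Let q i u := dotc (design_row X i) u.
Let Y := response X theta xi bstar.
Let r b i := residual X Y b i.
Let f := welsch_loss tau X Y.

Hypotheses (tau0 : 0 < tau) (n0 : (0 < n)%N) (c0 : 0 <= c) (K20 : 0 <= K2).
Hypothesis H1 : forall u, kappa * n%:R * enorm u ^+ 2 <= \sum_i q i u ^+ 2.
Hypothesis H2 : forall u, \sum_i q i u ^+ 2 <= K2 * n%:R * enorm u ^+ 2.
Hypothesis H3 : forall u (S : {set 'I_n}), #|S|%:R <= m ->
  \sum_(i in S) q i u ^+ 2 <= kappa' * n%:R * enorm u ^+ 2.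
(* [kappa / 5 - (50 + 1 / 5) kappa' >= kappa / 10]: the harmless rows contribute
   [1 / 5] of their quadratic form, the harmful ones at least [- 50]. *)
Hypothesis kk : 502 * kappa' <= kappa.
Hypothesis Hm : \sum_i (theta i 0 != 0)%:R
  + 16 * \sum_i Num.min 1 (tau * xi i 0 ^+ 2) + 32 * tau * K2 * n%:R * c ^+ 2 <= m.

Lemma welsch_strong_convexity b b' : basin bstar c b -> basin bstar c b' ->
  f b - n%:R^-1 * (\sum_i welsch_score tau (r b i) * q i (b' - b))
    + kappa / 10 * enorm (b' - b) ^+ 2 <= f b'.
Proof.
rewrite /basin /= => bc bc'.
have n0' : (0 : R) < n%:R by rewrite ltr0n.
pose h := b - bstar; pose h' := b' - bstar.
(* On a row passing all tests a residual is [xi_i - <X_i, h>], whose square times [tau] is at most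
   [2 (1/16 + 1/16) = 1/4], the range of [welsch_local_convexity]. *)
pose bad i := [|| theta i 0 != 0, 1 / 16 < tau * xi i 0 ^+ 2,
  1 / 16 < tau * q i h ^+ 2 | 1 / 16 < tau * q i h' ^+ 2].
pose S := [set i | bad i]%SET.
have qsum u : enorm u <= c -> \sum_i q i u ^+ 2 <= K2 * n%:R * c ^+ 2.
  move=> uc; apply: le_trans (H2 u) _; apply: ler_wpM2l; first by rewrite mulr_ge0// ltW.
  by rewrite lerXn2r ?nnegrE ?enorm_ge0.
(* A failed test contributes at least [1] to the sum of the tested quantities scaled by [16]; the
   two displacements together produce the [32] of [Hm]. *)
have Sm : #|S|%:R <= m.
  apply: le_trans Hm; rewrite -sum1_card natr_sum big_mkcond/=.
  have h1 := qsum h bc; have h2 := qsum h' bc'.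
  have : \sum_i (if i \in S then 1%:R else 0 : R) <=
     \sum_i ((theta i 0 != 0)%:R + 16 * Num.min 1 (tau * xi i 0 ^+ 2) +
       16 * tau * q i h ^+ 2 + 16 * tau * q i h' ^+ 2).
    apply: ler_sum => i _; rewrite inE.
    have e1 : 0 <= (theta i 0 != 0)%:R :> R by [].
    have e2 : 0 <= Num.min 1 (tau * xi i 0 ^+ 2).
      by rewrite le_min ler01 mulr_ge0 ?sqr_ge0// ltW.
    have e3 : 0 <= tau * q i h ^+ 2 by rewrite mulr_ge0 ?sqr_ge0// ltW.
    have e4 : 0 <= tau * q i h' ^+ 2 by rewrite mulr_ge0 ?sqr_ge0// ltW.
    case: ifPn => [|_]; last by rewrite -!(mulrA 16); lra.
    rewrite -!(mulrA 16); case/or4P => [->|g|g|g].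
    - by rewrite [true%:R]/=; lra.
    - have : 1 / 16 <= Num.min 1 (tau * xi i 0 ^+ 2) by rewrite le_min; apply/andP; split; lra.
      by lra.
    - by lra.
    - by lra.
  move=> /le_trans; apply; rewrite !big_split/= -!big_distrr/=.
  by move: h1 h2; rewrite -(ler_pM2l tau0) => h1; rewrite -(ler_pM2l tau0) => h2; lra.
have key i : tau * (welsch_score tau (r b i) * (- q i (b' - b)) +
     (q i (b' - b) ^+ 2 / 5 - (if i \in S then (50 + 1 / 5) * q i (b' - b) ^+ 2 else 0)))
   <= expR (- (tau / 2) * r b i ^+ 2) - expR (- (tau / 2) * r b' i ^+ 2).
  have rd : - q i (b' - b) = r b' i - r b i.
    rewrite /r !residualE -/(q i _) -/(q i (b - bstar)).
    rewrite (_ : b' - b = (b' - bstar) - (b - bstar)); last by rewrite opprB addrA subrK.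
    by rewrite [q i (_ - _ - _)]dotcBr /q; ring.
  rewrite -[q i (b' - b) ^+ 2]sqrrN rd; case: ifPn => iS.
    apply: le_trans (welsch_semiconvexity (r b i) (r b' i) tau0).
    by rewrite ler_pM2l//; lra.
  rewrite subr0; apply: welsch_local_convexity => //; rewrite /r residualE;
    move: iS; rewrite inE /bad !negb_or negbK -!leNgt => /and4P[/eqP -> x1 x2 x3];
    rewrite add0r -/(q i _).
  - rewrite -/h; have := mulr_ge0 (ltW tau0) (sqr_ge0 (xi i 0 + q i h)); nra.
  - rewrite -/h'; have := mulr_ge0 (ltW tau0) (sqr_ge0 (xi i 0 + q i h')); nra.
have : tau * (- (\sum_i welsch_score tau (r b i) * q i (b' - b)) + kappa / 10 * n%:R *
    enorm (b' - b) ^+ 2)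
   <= \sum_i (expR (- (tau / 2) * r b i ^+ 2) - expR (- (tau / 2) * r b' i ^+ 2)).
  apply: (@le_trans _ _ (\sum_i tau * (welsch_score tau (r b i) * (- q i (b' - b)) +
     (q i (b' - b) ^+ 2 / 5 - (if i \in S then (50 + 1 / 5) * q i (b' - b) ^+ 2 else
         0))))); last first.
    by apply: ler_sum => i _; exact: key.
  rewrite -big_distrr/= ler_pM2l// big_split/= sumrB -big_mkcond/= -!big_distrr -big_distrl/=.
  under [X in _ <= X + _]eq_bigr do rewrite mulrN.
  rewrite sumrN lerD2l.
  have := H1 (b' - b); have := H3 (b' - b) Sm; have := sqr_ge0 (enorm (b' - b)).
  move: (enorm _ ^+ 2) => D D0 h3 h1.
  have nD : 0 <= n%:R * D by rewrite mulr_ge0// ltW.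
  have := ler_wpM2r nD kk.
  lra.
move=> H; rewrite /f /welsch_loss.
set G := \sum_i welsch_score tau (r b i) * q i (b' - b) in H *.
have ti : 0 < (tau * n%:R)^-1 by rewrite invr_gt0 mulr_gt0.
have := ler_wpM2l (ltW ti) H.
rewrite sumrB.
set S1 := \sum_i expR (- (tau / 2) * r b i ^+ 2).
set S2 := \sum_i expR (- (tau / 2) * r b' i ^+ 2).
rewrite !sumrB -/S1 -/S2.
have -> : (tau * n%:R)^-1 * (tau * (- G + kappa / 10 * n%:R * enorm (b' - b) ^+ 2))
   = - (n%:R^-1 * G) + kappa / 10 * enorm (b' - b) ^+ 2.
  by field; rewrite !gt_eqF.
move=> ?; lra.
Qed.

End deterministic.

(** * Existence and uniqueness of a minimizer over the basin *)

Lemma continuous_sumr (R : realType) (V : topologicalType) (n : nat)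
    (f : 'I_n -> V -> R) :
  (forall i, continuous (f i)) -> continuous (fun t => \sum_(i < n) f i t).
Proof.
move=> cf t; apply: cvg_big => [|i _]; last exact: cf.
exact: add_continuous.
Qed.

(** The extreme value theorem is applied to row vectors, hence the functions of [t^T] here and
    below. *)
Lemma continuous_coordT (R : realType) (p : nat) (j : 'I_p) :
  continuous (fun t : 'rV[R]_p => t^T j 0).
Proof.
rewrite (_ : (fun t : 'rV[R]_p => t^T j 0) = (fun t => t 0 j)).
  exact: coord_continuous.
by apply/funext => t; rewrite mxE.
Qed.

Lemma continuous_row_dotc (R : realType) (p : nat) (u : 'cV[R]_p) :
  continuous (fun t : 'rV[R]_p => dotc u t^T).
Proof.
apply: continuous_sumr => j t; apply: continuousM; first exact: cst_continuous.
exact: continuous_coordT.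
Qed.

Lemma welsch_loss_continuous (R : realType) (n p : nat) (tau : R)
    (X : 'M[R]_(n, p)) (Y : 'cV[R]_n) :
  continuous (fun t : 'rV[R]_p => welsch_loss tau X Y t^T).
Proof.
rewrite /welsch_loss.
pose g i (t : 'rV[R]_p) := 1 - expR (- (tau / 2) * residual X Y t^T i ^+ 2).
suff h : continuous (fun t => \sum_(i < n) g i t).
  by move=> t; exact: (continuousM (@cst_continuous _ _ (tau * n%:R)^-1 t) (h t)).
apply: continuous_sumr => i t.
have h : {for t, continuous (fun t : 'rV[R]_p => residual X Y t^T i)}.
  by apply: continuousB; [exact: cst_continuous|exact: continuous_row_dotc].
have h2 : {for t, continuous (fun t : 'rV[R]_p => - (tau / 2) * residual X Y t^T i ^+ 2)}.
  apply: continuousM; first exact: cst_continuous.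
  exact: (continuousM h h).
have h3 := continuous_comp h2 (@continuous_expR R _).
rewrite (_ : g i = cst 1 - (expR \o (fun t => - (tau / 2) * residual X Y t^T i ^+ 2)))//.
exact: continuousB (@cst_continuous _ _ (1 : R) t) h3.
Qed.

Lemma basin_compact (R : realType) (p : nat) (bstar : 'cV[R]_p) (c : R) :
  compact [set t : 'rV[R]_p | basin bstar c t^T].
Proof.
apply: bounded_closed_compact.
  exists (c + enorm bstar); split; first exact: num_real.
  move=> M cM t /= ht.
  rewrite /Num.norm/= mx_normrE; apply/bigmax_leP; split.
    have := enorm_ge0 bstar; have := enorm_ge0 (t^T - bstar); move: ht; rewrite /basin/=; lra.
  move=> [i j] _ /=; rewrite ord1.
  have -> : t 0 j = t^T j 0 by rewrite mxE.
  apply: le_trans (coord_le_enorm _ _) _.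
  rewrite -[t^T](subrK bstar); apply: le_trans (enormD _ _) _.
  move: ht; rewrite /basin/=; lra.
(* Closedness is read off the squared constraint, which describes the ball only for [0 <= c]. *)
have [c0|c0] := ltP c 0.
  rewrite (_ : [set _ | _] = set0); first exact: closed0.
  apply/seteqP; split => t //=; rewrite /basin/=; have := enorm_ge0 (t^T - bstar); lra.
rewrite (_ : [set _ | _] = (fun t : 'rV[R]_p => dotc (t^T - bstar) (t^T - bstar)) @^-1`
    [set x | x <= c ^+ 2]).
  apply: preimage_closed; last exact: closed_le.
  move=> t _; move: t; apply: continuous_sumr => j t.
  have h : {for t, continuous (fun t : 'rV[R]_p => (t^T - bstar) j 0)}.
    rewrite (_ : (fun t : 'rV[R]_p => _) = (fun t : 'rV[R]_p => t^T j 0 - bstar j 0)).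
      by apply: continuousB; [exact: continuous_coordT|exact: cst_continuous].
    by apply/funext => t'; rewrite !mxE.
  exact: (continuousM h h).
apply/seteqP; split => t /=; rewrite /basin/= -enorm_sqr => h.
  by rewrite lerXn2r ?nnegrE ?enorm_ge0.
by rewrite -(@ler_pXn2r _ 2)// ?nnegrE ?enorm_ge0.
Qed.

(** Expanding at the midpoint of two minimizers, the linear terms cancel by oddness of [G] and the
    quadratic terms force equality. Comparison with [f bstar] gives [k D^2 <= g D]. *)
Lemma strongly_convex_minimizer (R : realType) (p : nat) (f : 'cV[R]_p -> R)
    (G : 'cV[R]_p -> 'cV[R]_p -> R) (bstar : 'cV[R]_p) (c k g : R) :
  continuous (fun t : 'rV[R]_p => f t^T) -> 0 <= c -> 0 < k -> 0 <= g ->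
  (forall b u, G b (- u) = - G b u) ->
  (forall b b', basin bstar c b -> basin bstar c b' ->
     f b - G b (b' - b) + k * enorm (b' - b) ^+ 2 <= f b') ->
  (forall u, G bstar u <= g * enorm u) ->
  exists2 bhat, forall b, minimizer_over f (basin bstar c) b <-> b = bhat &
    enorm (bhat - bstar) <= g / k.
Proof.
move=> cf c0 k0 g0 GN H Gg.
have Sb : basin bstar c bstar by rewrite /basin/= subrr enorm0.
have [t tA ft] : exists2 t, t \in [set t : 'rV[R]_p | basin bstar c t^T] &
   forall t', t' \in [set t : 'rV[R]_p | basin bstar c t^T] -> f t^T <= f t'^T.
  apply: EVT_min_rV.
  - by exists bstar^T; rewrite /= trmxK.
  - exact: basin_compact.
  - exact: continuous_subspaceT.
have tb : basin bstar c t^T by rewrite inE in tA.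
have tmin : minimizer_over f (basin bstar c) t^T.
  by split=> // b' Sb'; rewrite -[b']trmxK; apply: ft; rewrite inE/= trmxK.
exists t^T => [b|].
  split => [[Sb1 bmin]|->//].
  pose m := (1 / 2) *: (b + t^T).
  have Sm : basin bstar c m.
    rewrite /basin/= (_ : m - bstar = (1 / 2) *: ((b - bstar) + (t^T - bstar))).
      rewrite enormZ ger0_norm; last lra.
      have := enormD (b - bstar) (t^T - bstar).
      by move: Sb1 tb; rewrite /basin/=; lra.
    by rewrite /m; apply/matrixP => i j; rewrite !mxE; lra.
  have e : t^T - m = - (b - m).
    by rewrite /m; apply/matrixP => i j; rewrite !mxE; lra.
  have h1 := H m b Sm Sb1; have h2 := H m t^T Sm tb.
  rewrite e GN enormN in h2.
  have h3 := bmin m Sm; have h4 := tmin.2 m Sm.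
  have z : enorm (b - m) ^+ 2 <= 0 by rewrite -(ler_pM2l k0) mulr0; lra.
  have : enorm (b - m) = 0.
    by apply/eqP; rewrite -sqrf_eq0 eq_le z sqr_ge0.
  move=> /enorm_eq0 bm; have := e; rewrite bm oppr0 => tm.
  by rewrite -[b](subrK m) bm -[t^T](subrK m) tm.
have := H bstar t^T Sb tb; have := tmin.2 _ Sb; have := Gg (t^T - bstar).
set D := enorm _ => h1 h2 h3.
have D0 : 0 <= D by exact: enorm_ge0.
rewrite ler_pdivlMr//; have [->|Dn] := eqVneq D 0; first by rewrite mul0r.
have Dp : 0 < D by rewrite lt_def Dn.
by rewrite -(ler_pM2l Dp); nra.
Qed.

(** * Quadratic and linear forms of the design *)

Section sparse_forms.
Context (R : realType) (n p : nat) (X : 'M[R]_(n, p)) (s : seq 'cV[R]_p).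
Let q i u := dotc (design_row X i) u.

(** Zeroing rows, and not deleting them, turns a form restricted to [S] into a squared norm with
    fixed dimensions, to which the net lemmas apply. *)
Definition restrict_rows (S : {set 'I_n}) : 'M[R]_(n, p) :=
  \matrix_(i, j) (if i \in S then X i j else 0).

Lemma enorm_restrict_rows S u :
  enorm (restrict_rows S *m u) ^+ 2 = \sum_(i in S) q i u ^+ 2.
Proof.
rewrite enorm_sqr /dotc [RHS]big_mkcond/=; apply: eq_bigr => i _.
have -> : (restrict_rows S *m u) i 0 = if i \in S then q i u else 0.
  rewrite mxE; case: ifP => iS.
    by apply: eq_bigr => j _; rewrite !mxE iS.
  by rewrite big1// => j _; rewrite !mxE iS mul0r.
by case: ifP => _; rewrite ?mulr0// expr2.
Qed.

Lemma restrict_rowsT u : enorm (restrict_rows [set: 'I_n] *m u) ^+ 2 = \sum_i q i u ^+ 2.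
Proof. by rewrite enorm_restrict_rows; apply: eq_bigl => i; rewrite inE. Qed.

Lemma net_sparse_forms (e t E : R) : covers_ball e s -> e <= 1 / 2 ->
  0 <= t -> 0 <= E ->
  (forall v, v \in s -> \sum_i Num.max (q i v ^+ 2 - t) 0 <= E) ->
  forall (S : {set 'I_n}) u,
    \sum_(i in S) q i u ^+ 2 <= 4 * (#|S|%:R * t + E) * enorm u ^+ 2.
Proof.
move=> cs e2 t0 E0 sE S u.
have B0 : 0 <= #|S|%:R * t + E by rewrite addr_ge0// mulr_ge0.
have h : enorm (restrict_rows S *m u) <= 2 * Num.sqrt (#|S|%:R * t + E) * enorm u.
  apply: net_opnorm cs e2 _ _ => v vs.
  rewrite -(@ler_pXn2r _ 2)// ?nnegrE ?sqrtr_ge0 ?enorm_ge0//.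
  rewrite enorm_restrict_rows (sqr_sqrtr B0).
  apply: (@le_trans _ _ (\sum_(i in S) (t + Num.max (q i v ^+ 2 - t) 0))).
    by apply: ler_sum => i _; rewrite -lerBlDl le_max lexx.
  rewrite big_split/= sumr_const -[t *+ _]mulr_natl lerD2l.
  apply: le_trans (sE v vs); rewrite big_mkcond; apply: ler_sum => i _.
  by case: ifP => _ //; rewrite le_max lexx orbT.
rewrite -enorm_restrict_rows.
have -> : 4 * (#|S|%:R * t + E) * enorm u ^+ 2 = (2 * Num.sqrt (#|S|%:R * t + E) * enorm u) ^+ 2.
  by rewrite !exprMn (sqr_sqrtr B0); ring.
by rewrite lerXn2r ?nnegrE ?enorm_ge0// mulr_ge0 ?enorm_ge0// mulr_ge0 ?sqrtr_ge0.
Qed.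

Lemma net_lower_form (e K2 : R) : (0 < n)%N -> covers_ball e s -> 0 <= e -> e <= 1 / 4 ->
  0 <= K2 -> e * Num.sqrt K2 <= 1 / 4 ->
  (forall v, v \in s -> 1 / 2 <= enorm v -> n%:R / 2 * enorm v ^+ 2 <= \sum_i q i v ^+ 2) ->
  (forall u, \sum_i q i u ^+ 2 <= K2 * n%:R * enorm u ^+ 2) ->
  forall u, 1 / 16 * n%:R * enorm u ^+ 2 <= \sum_i q i u ^+ 2.
Proof.
move=> n0 cs e0 e4 K20 eK sl H u.
have n0' : (0 : R) < n%:R by rewrite ltr0n.
have n1 : 0 <= n%:R / 2 :> R by rewrite divr_ge0.
have nK : 0 <= K2 * n%:R by rewrite mulr_ge0.
set A := restrict_rows [set: 'I_n].
have low : (Num.sqrt (n%:R / 2) * (1 - e) - Num.sqrt (K2 * n%:R) * e) * enorm u <= enorm (A *m u).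
  apply: (@net_lower _ _ s _ A) => //; rewrite ?sqrtr_ge0//; first lra.
    move=> v vs v2.
    rewrite -(@ler_pXn2r _ 2)// ?nnegrE ?mulr_ge0 ?sqrtr_ge0 ?enorm_ge0//.
    by rewrite exprMn (sqr_sqrtr n1) restrict_rowsT; exact: sl.
  move=> v; rewrite -(@ler_pXn2r _ 2)// ?nnegrE ?mulr_ge0 ?sqrtr_ge0 ?enorm_ge0//.
  by rewrite exprMn (sqr_sqrtr nK) restrict_rowsT; exact: H.
have sn : 0 < Num.sqrt n%:R :> R by rewrite sqrtr_gt0.
have s2 : 7 / 10 * Num.sqrt n%:R <= Num.sqrt (n%:R / 2) :> R.
  have c7 : 0 <= 7 / 10 :> R by lra.
  rewrite -(@ler_pXn2r _ 2)// ?nnegrE ?sqrtr_ge0 ?(mulr_ge0 c7 (ltW sn))//.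
  by rewrite exprMn !sqr_sqrtr//; lra.
(* Numerically [7/10 * 3/4 - 1/4 >= 1/4], whose square is the [1 / 16] of the conclusion. *)
have low2 : 1 / 4 * Num.sqrt n%:R <= Num.sqrt (n%:R / 2) * (1 - e) - Num.sqrt (K2 * n%:R) * e.
  rewrite [Num.sqrt (K2 * _)]sqrtrM//.
  have h1 : 7 / 10 * Num.sqrt n%:R * (3 / 4) <= Num.sqrt (n%:R / 2) * (1 - e).
    by apply: ler_pM; lra.
  have h2 := ler_wpM2r (ltW sn) eK.
  nra.
rewrite -restrict_rowsT -/A.
have h : 1 / 4 * Num.sqrt n%:R * enorm u <= enorm (A *m u).
  by apply: le_trans low; apply: ler_wpM2r => //; exact: enorm_ge0.
have -> : 1 / 16 * n%:R * enorm u ^+ 2 = (1 / 4 * Num.sqrt n%:R * enorm u) ^+ 2.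
  by rewrite !exprMn (sqr_sqrtr (ltW n0')); field.
have c4 : 0 <= 1 / 4 :> R by lra.
by rewrite lerXn2r ?nnegrE ?enorm_ge0// mulr_ge0 ?enorm_ge0// (mulr_ge0 c4 (ltW sn)).
Qed.

Lemma sparse_linear_form (S : {set 'I_n}) (a : 'I_n -> R) (B D : R) u : 0 <= B -> 0 <= D ->
  (forall i, i \in S -> a i ^+ 2 <= B) ->
  \sum_(i in S) q i u ^+ 2 <= D * enorm u ^+ 2 ->
  \sum_(i in S) a i * q i u <= Num.sqrt (#|S|%:R * B * D) * enorm u.
Proof.
move=> B0 D0 aB qD.
pose x : 'cV[R]_n := \col_i (if i \in S then a i else 0).
pose y : 'cV[R]_n := \col_i (if i \in S then q i u else 0).
have -> : \sum_(i in S) a i * q i u = dotc x y.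
  rewrite big_mkcond; apply: eq_bigr => i _; rewrite !mxE.
  by case: ifP => _ //; rewrite mulr0.
apply: le_trans (cauchy_schwarz x y) _.
have xB : enorm x <= Num.sqrt (#|S|%:R * B).
  rewrite /enorm ler_sqrt ?mulr_ge0// /dotc.
  rewrite mulr_natl -sumr_const [leRHS]big_mkcond; apply: ler_sum => i _.
  by rewrite mxE; case: ifP => [/aB|_]; rewrite ?mulr0// expr2.
have yD : enorm y <= Num.sqrt D * enorm u.
  rewrite -(@ler_pXn2r _ 2)// ?nnegrE ?mulr_ge0 ?sqrtr_ge0 ?enorm_ge0//.
  rewrite exprMn (sqr_sqrtr D0) enorm_sqr; apply: le_trans qD.
  rewrite /dotc [leRHS]big_mkcond; apply: ler_sum => i _.
  by rewrite mxE; case: ifP => _; rewrite ?mulr0// expr2.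
by rewrite sqrtrM ?mulr_ge0// -mulrA; apply: ler_pM; rewrite ?enorm_ge0.
Qed.

End sparse_forms.

(** * Random events *)

Lemma measurable_coord (R : realType) (m n : nat) (i : 'I_m) (j : 'I_n) :
  measurable_fun setT (fun x : borel_mx R m n => x i j).
Proof.
apply: (measurability _ (RGenOpens.measurableE R)) => _ [_ [a [b ->] <-]].
rewrite setTI; apply: sub_sigma_algebra => /=.
by apply: open_comp (interval_open _ _) => // x _; exact: coord_continuous.
Qed.

Lemma continuous_design_row (R : realType) (n p : nat) (i : 'I_n) :
  continuous (fun X : 'M[R]_(n, p) => design_row X i).
Proof.
move=> X A /= /nbhs_ballP[e e0 eA]; apply/nbhs_ballP; exists e => // X' [_ XX'].
by apply: eA; split => // j k; rewrite !mxE; exact: XX'.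
Qed.

Lemma measurable_design_row d (T : measurableType d) (R : realType) (n p : nat)
    (X : T -> 'M[R]_(n, p)) (i : 'I_n) : random_mx X ->
  measurable_fun setT (fun w => design_row (X w) i : borel_mx R p 1).
Proof.
move=> mX; have h : measurable_fun setT (fun x : borel_mx R n p => design_row x i : borel_mx R p 1).
  apply: (@measurability _ _ _ (borel_mx R p 1) _ _ (@open 'M[R]_(p, 1))) => //.
  move=> _ [A oA <-].
  rewrite setTI; apply: sub_sigma_algebra => /=.
  by apply: open_comp oA => x _; exact: continuous_design_row.
exact: (measurableT_comp h mX).
Qed.

Lemma measurable_dotc d (T : measurableType d) (R : realType) (p : nat)
    (f : T -> borel_mx R p 1) (v : 'cV[R]_p) :
  measurable_fun setT f -> measurable_fun setT (fun w => dotc (f w) v).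
Proof.
move=> mf; apply: measurable_sum => j; apply: measurable_funM => //.
exact: (measurableT_comp (@measurable_coord R p 1 j 0) mf).
Qed.

Section design_moments.
Context d (T : measurableType d) (R : realType) (P : probability T R) (n p : nat)
  (X : T -> 'M[R]_(n, p)).
Hypotheses (mX : random_mx X) (sX : subgaussian_design P X).
Let q i w v := dotc (design_row (X w) i) v.

Let mq i v : measurable_fun setT (fun w => q i w v).
Proof. by apply: measurable_dotc; exact: measurable_design_row. Qed.

Lemma design_mgf i v (k : R) : enorm v <= 1 ->
  (\int[P]_w (expR (k * q i w v))%:E <= (expR (k ^+ 2 / 2))%:E)%E.
Proof.
move=> v1; have [_ _ _ /(_ i (k *: v))] := sX.
rewrite unlock => h; apply: (@le_trans _ _ (expR (enorm (k *: v) ^+ 2 / 2))%:E).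
  apply: le_trans h; rewrite le_eqVlt; apply/orP; left; apply/eqP.
  by apply: eq_integral => w _; rewrite dotcZl dotcC.
rewrite lee_fin ler_expR enormZ exprMn real_normK ?num_real//.
have v2 : enorm v ^+ 2 <= 1 by rewrite expr_le1// enorm_ge0.
by have := ler_wpM2l (sqr_ge0 k) v2; lra.
Qed.

Let mXij i j : measurable_fun setT (fun w => X w i j).
Proof. exact: (measurableT_comp (@measurable_coord R n p i j) mX). Qed.

Lemma design_isotropic i v : (\int[P]_w (q i w v ^+ 2)%:E = (enorm v ^+ 2)%:E)%E.
Proof.
have cov j k : (\int[P]_w (X w i j * X w i k)%:E = (j == k)%:R%:E)%E.
  have [_ _ /(_ i j k) + _] := sX; rewrite unlock mxE => <-.
  by apply: eq_integral => w _; rewrite mxE big_ord1 !mxE.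
(* Integrability of the cross products comes from the diagonal second moments, which are [1]; it is
   what permits expanding the square. *)
have int j k : P.-integrable setT (fun w => (X w i j * X w i k)%:E).
  apply/integrableP; split.
    by apply/measurable_EFinP; exact: measurable_funM.
  apply: (@le_lt_trans _ _ (\int[P]_w ((X w i j * X w i j)%:E + (X w i k * X w i k)%:E))%E).
    apply: ge0_le_integral => //.
    - apply: measurableT_comp => //.
      by apply/measurable_EFinP; exact: measurable_funM.
    - by apply/measurable_EFinP; apply: measurable_funD; exact: measurable_funM.
    - move=> w _; rewrite -EFinD lee_fin ler_norml.
      have := sqr_ge0 (X w i j + X w i k); have := sqr_ge0 (X w i j - X w i k).
      have := sqr_ge0 (X w i j); have := sqr_ge0 (X w i k); rewrite !expr2; lra.
  rewrite ge0_integralD//.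
  - by rewrite !cov !eqxx -EFinD ltry.
  - by move=> w _; rewrite lee_fin -expr2 sqr_ge0.
  - by apply/measurable_EFinP; exact: measurable_funM.
  - by move=> w _; rewrite lee_fin -expr2 sqr_ge0.
  - by apply/measurable_EFinP; exact: measurable_funM.
rewrite (eq_integral (fun w => \sum_(jk : 'I_p * 'I_p) (v jk.1 0 * v jk.2 0)%:E * (X w i
    jk.1 * X w i jk.2)%:E)%E); last first.
  move=> w _; rewrite (eq_bigr (fun jk => (v jk.1 0 * v jk.2 0 * (X w i jk.1 * X w i jk.2))%:E))//.
  rewrite sumEFin; congr EFin.
  rewrite -(pair_bigA _ (fun j k => v j 0 * v k 0 * (X w i j * X w i k)))/=.
  rewrite expr2 /q /dotc big_distrl/=; apply: eq_bigr => j _.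
  rewrite big_distrr/=; apply: eq_bigr => k _; rewrite !mxE; ring.
rewrite integral_sum//; last by move=> jk; apply: integrableZl.
rewrite (eq_bigr (fun jk => (v jk.1 0 * v jk.2 0 * (jk.1 == jk.2)%:R)%:E)); last first.
  by move=> jk _; rewrite integralZl// cov -EFinM.
rewrite sumEFin -(pair_bigA _ (fun j k => v j 0 * v k 0 * (j == k)%:R))/=.
congr EFin; rewrite enorm_sqr; apply: eq_bigr => j _.
rewrite (bigD1 j)//= eqxx mulr1 big1 ?addr0// => k kj.
by rewrite eq_sym (negbTE kj) mulr0.
Qed.

Variables (K : R).
Hypothesis HK : forall (Z : T -> R),
    measurable_fun setT Z ->
    (forall k : R, (\int[P]_w (expR (k * Z w))%:E <= (expR (k ^+ 2 / 2))%:E)%E) ->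
    (\int[P]_w (expR (Z w ^+ 2 / 4))%:E <= K%:E)%E.

Let mE (h : R -> R) v : measurable_fun setT h ->
  measurable_fun setT (fun x : borel_mx R p 1 => h (dotc x v)).
Proof.
move=> mh; apply: measurableT_comp => //.
exact: (@measurable_dotc _ (borel_mx R p 1)).
Qed.

Let mixing (h : R -> R) (b : R) v : measurable_fun setT h ->
  (forall i, (\int[P]_w (expR (h (q i w v)))%:E <= (expR b)%:E)%E) ->
  (\int[P]_w (expR (\sum_i h (q i w v)))%:E <= (expR (n%:R * b))%:E)%E.
Proof.
move=> mh hb; have [[ind _] _ _ _] := sX.
have := @integral_expR_sum_le _ T R P _ (borel_mx R p 1) 'I_n
  (fun i w => design_row (X w) i) (fun _ x => h (dotc x v)) (fun _ => b) ind.
rewrite sumr_const card_ord -[b *+ n]mulr_natl; apply; last exact: hb.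
- by move=> i; exact: measurable_design_row.
- by move=> i; exact: mE.
Qed.

Variables (s : seq 'cV[R]_p) (M : R).
Hypotheses (s1 : forall v, v \in s -> enorm v <= 1) (sM : (size s)%:R <= expR M).

Lemma excess_event (t u : R) : exists B, [/\ measurable B, (P B <= (expR (- u))%:E)%E &
  forall w, ~ B w -> forall v, v \in s ->
    \sum_i Num.max (q i w v ^+ 2 - t) 0 <= 4 * (n%:R * (K * expR (- t / 4)) + M + u)].
Proof.
pose h (x : R) := Num.max (x ^+ 2 - t) 0 / 4.
have mh : measurable_fun setT h.
  apply: measurable_funM => //; apply: measurable_maxr => //.
  by apply: measurable_funB => //; exact: measurable_funX.
have [|v vs|B [mB PB HB]] := @exp_moment_seq _ T R P _ s (fun v w => \sum_i h (q i w v))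
    (n%:R * (K * expR (- t / 4))) M u _ _ sM.
- move=> v; apply: measurable_sum => i; apply: (measurableT_comp mh); exact: mq.
- apply: mixing => // i; apply: excess_sqr_mgf; first exact: mq.
  by apply: HK; [exact: mq|move=> k; apply: design_mgf; exact: s1].
exists B; split => // w Bw v vs; have := HB w Bw v vs.
by rewrite /h -big_distrl/=; lra.
Qed.

Lemma lower_event (la u : R) : 0 <= la ->
  exists B, [/\ measurable B, (P B <= (expR (- u))%:E)%E &
  forall w, ~ B w -> forall v, v \in s ->
    la * (n%:R * enorm v ^+ 2) <= la * \sum_i q i w v ^+ 2 + (n%:R * (la ^+ 2 * (32 * K)) + M + u)].
Proof.
move=> la0.
(* Centring by [la * enorm v ^+ 2] makes the moment bound the same for all net points, as
   [exp_moment_seq] requires. *)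
pose h (v : 'cV[R]_p) (x : R) : R := - la * x ^+ 2 + la * enorm v ^+ 2.
have mh v : measurable_fun setT (h v).
  apply: measurable_funD => //; apply: measurable_funM => //.
have [|v vs|B [mB PB HB]] := @exp_moment_seq _ T R P _ s (fun v w => \sum_i h v (q i w v))
    (n%:R * (la ^+ 2 * (32 * K))) M u _ _ sM.
- move=> v; apply: measurable_sum => i; apply: (measurableT_comp (mh v)); exact: mq.
- apply: mixing => // i; rewrite /h.
  under eq_integral do rewrite expRD mulrC EFinM.
  rewrite ge0_integralZl//; last first.
    apply/measurable_EFinP; apply: measurableT_comp => //; apply: measurable_funM => //.
    by apply: measurable_funX; exact: mq.
  have := @lower_sqr_mgf _ T R P (fun w => q i w v) K (mq i v) _ (enorm v ^+ 2) la la0 _.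
  rewrite design_isotropic => /(_ _ (lexx _)) H.
  apply: (@le_trans _ _ ((expR (la * enorm v ^+ 2))%:E *
      (expR (- la * enorm v ^+ 2 + la ^+ 2 * (32 * K)))%:E)%E).
    apply: lee_wpmul2l; first by rewrite lee_fin expR_ge0.
    by apply: H; apply: HK; [exact: mq|move=> k; apply: design_mgf; exact: s1].
  by rewrite -EFinM -expRD lee_fin ler_expR; lra.
exists B; split => // w Bw v vs; have := HB w Bw v vs.
rewrite /h big_split/= sumr_const card_ord -big_distrr/= -[_ *+ n]mulr_natr; lra.
Qed.

End design_moments.

Section noise_events.
Context d (T : measurableType d) (R : realType) (P : probability T R) (n : nat)
  (xi : T -> 'cV[R]_n) (l : \bar R) (a : R).
Hypotheses (mxi : random_mx xi) (nxi : noise_assumption P xi l a).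

Let mx i : measurable_fun setT (fun w => xi w i 0).
Proof. exact: (measurableT_comp (@measurable_coord R n 1 i 0) mxi). Qed.

Lemma noise_second_moment i : (\int[P]_w (xi w i 0 ^+ 2)%:E = 1)%E.
Proof.
have [_ /(_ i) m1 /(_ i) + _] := nxi.
rewrite /variance unlock m1 /= unlock => <-.
apply: eq_integral => w _ /=. by rewrite expr2 -[xi w i 0]subr0.
Qed.

Variable tau : R.
Hypothesis tau0 : 0 < tau.
(** The same truncated square bounds both the number of rows with large noise and [tau] times the
    energy of the score. *)
Let clip (x : R) := Num.min 1 (tau * x ^+ 2).

Let mclip : measurable_fun setT clip.
Proof. by apply: measurable_minr => //; apply: measurable_funM => //; exact: measurable_funX. Qed.

Let clip0 x : 0 <= clip x.
Proof. by rewrite le_min ler01 mulr_ge0 ?sqr_ge0// ltW. Qed.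

Let clip_mean i : (\int[P]_w (clip (xi w i 0))%:E <= tau%:E)%E.
Proof.
apply: (@le_trans _ _ (\int[P]_w (tau%:E * (xi w i 0 ^+ 2)%:E))%E).
  apply: ge0_le_integral => //.
  - by move=> w _; rewrite lee_fin.
  - by apply/measurable_EFinP; exact: measurableT_comp.
  - by apply/measurable_EFinP; apply: measurable_funM => //; exact: measurable_funX.
  - by move=> w _; rewrite -EFinM lee_fin ge_min lexx orbT.
rewrite ge0_integralZl//.
- by rewrite noise_second_moment mule1.
- by apply/measurable_EFinP; exact: measurable_funX.
- by move=> w _; rewrite lee_fin sqr_ge0.
- by rewrite lee_fin ltW.
Qed.

Lemma clipped_noise_exp_event (u : R) :
  exists B, [/\ measurable B, (P B <= (expR (- u))%:E)%E &
    forall w, ~ B w -> \sum_i clip (xi w i 0) <= 5 / 4 * n%:R * tau + 4 * u].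
Proof.
have [[ind _] _ _ _] := nxi.
have mom i : (\int[P]_w (expR (clip (xi w i 0) / 4))%:E <= (expR (5 / 16 * tau))%:E)%E.
  apply: (@le_trans _ _ (\int[P]_w (1%:E + (5 / 16)%:E * (clip (xi w i 0))%:E))%E).
    apply: ge0_le_integral => //.
    - apply/measurable_EFinP; apply: measurableT_comp => //; apply: measurable_funM => //.
      exact: measurableT_comp.
    - apply/measurable_EFinP; apply: measurable_funD => //; apply: measurable_funM => //.
      exact: measurableT_comp.
    - move=> w _; rewrite -EFinM -EFinD lee_fin.
      have c0 := clip0 (xi w i 0).
      have c1 : clip (xi w i 0) <= 1 by rewrite ge_min lexx.
      have := @expR_le_quadratic R (clip (xi w i 0) / 4) _.
      (* For [0 <= c <= 1], [1 + c/4 + c^2/16 <= 1 + 5c/16], the source of the factor [5 / 4] once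
         multiplied by [4]. *)
      move: (clip _) c0 c1 => c c0 c1 h.
      by apply: (le_trans (h _)); nra.
  rewrite ge0_integralD//; last 2 first.
  - by move=> w _; rewrite -EFinM lee_fin mulr_ge0//; lra.
  - apply/measurable_EFinP; apply: measurable_funM => //; exact: measurableT_comp.
  rewrite integral_cst// [X in (1 * X)%E]probability_setT mule1.
  rewrite ge0_integralZl//; last 2 first.
  - by apply/measurable_EFinP; exact: measurableT_comp.
  - by move=> w _; rewrite lee_fin.
  apply: (@le_trans _ _ (1%:E + (5 / 16)%:E * tau%:E)%E).
    by apply: leeD => //; apply: lee_wpmul2l => //; rewrite lee_fin; lra.
  by rewrite -EFinM -EFinD lee_fin expR_ge1Dx.
have [||//|B [mB PB HB]] := @exp_moment_seq _ T R P _ [:: tt]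
  (fun _ w => \sum_i clip (xi w i 0) / 4) (n%:R * (5 / 16 * tau)) 0 u _ _.
- move=> _; apply: measurable_sum => i; apply: measurable_funM => //; exact: measurableT_comp.
- move=> _ _.
  have := @integral_expR_sum_le _ T R P _ R 'I_n
    (fun i w => xi w i 0) (fun _ x => clip x / 4) (fun _ => 5 / 16 * tau) ind.
  rewrite sumr_const card_ord -[_ *+ n]mulr_natl; apply; [exact: mx| |exact: mom].
  by move=> i; exact: measurable_funM.
- by rewrite expR0.
exists B; split => // w Bw; have := HB w Bw tt; rewrite inE -big_distrl/= => /(_ (eqxx _)).
lra.
Qed.

(* For small [L] the scale [tau] may be far below [1 / n], and the additive term of
   the exponential bound would be too large; [delta] is then bounded below and
   Markov's inequality suffices. *)
Lemma clipped_noise_event (L : R) : (0 < n)%N -> 0 < L ->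
  exists B, [/\ measurable B, (P B <= (expR (- L) / 6)%:E)%E &
    forall w, ~ B w -> \sum_i clip (xi w i 0) <= 20 * n%:R * tau + 12 * L].
Proof.
move=> n0 L0; have n0' : (0 : R) < n%:R by rewrite ltr0n.
have nt : 0 < n%:R * tau by rewrite mulr_gt0.
have [L1|L1] := leP L 1.
  pose S w := \sum_i clip (xi w i 0).
  have mS : measurable_fun setT S by apply: measurable_sum => i; exact: measurableT_comp.
  have S0 w : 0 <= S w by exact: sumr_ge0.
  have IS : (\int[P]_w (S w)%:E <= (n%:R * tau)%:E)%E.
    rewrite /S; under eq_integral do rewrite -sumEFin.
    rewrite ge0_integral_sum//; last 2 first.
    - by move=> i; apply/measurable_EFinP; exact: measurableT_comp.
    - by move=> i w _; rewrite lee_fin.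
    apply: (@le_trans _ _ (\sum_(i < n) tau%:E)%E).
      by apply: lee_sum => i _; exact: clip_mean.
    by rewrite sumEFin sumr_const card_ord -[_ *+ n]mulr_natl.
  have a0 : 0 < 20 * (n%:R * tau) by rewrite mulr_gt0.
  exists [set w | 20 * (n%:R * tau) <= S w]; split.
  - rewrite -[X in measurable X]setTI; exact: measurable_fun_ler.
  - apply: (le_trans (markov_ge0 mS S0 IS a0)).
    rewrite lee_fin invfM mulrCA divff ?gt_eqF// mulr1.
    (* The goal is [1 / 20 <= expR (- L) / 6] for [L <= 1], and [(3/4)^4 / 6] already exceeds
       [1 / 20]. *)
    have e4 : 3 / 4 <= expR (- (1 / 4)) :> R by have := expR_ge1Dx (- (1 / 4) : R); lra.
    have : (3 / 4 : R) ^+ 4 <= expR (- L).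
      apply: (@le_trans _ _ (expR (- (1 / 4)) ^+ 4)); first by rewrite lerXn2r// nnegrE
          ?expR_ge0//; lra.
      by rewrite -expRM_natl ler_expR; lra.
    lra.
  - by move=> w /= /negP; rewrite -ltNge /S => h; lra.
have [B [mB PB HB]] := clipped_noise_exp_event (L + ln 6).
exists B; split => //.
  by apply: (le_trans PB); rewrite lee_fin opprD expRD [expR (- ln 6)]expRN lnK// posrE.
move=> w Bw; apply: (le_trans (HB w Bw)).
(* As [L > 1], this gives [4 (L + ln 6) <= 12 L]. *)
have l6 : ln 6 <= 2 :> R.
  rewrite -[leRHS]expRK ler_ln ?posrE ?expR_gt0//.
  have e5 : 6 / 5 <= expR (1 / 5) :> R by have := expR_ge1Dx (1 / 5 : R); lra.
  have : (6 / 5 : R) ^+ 10 <= expR 2.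
    apply: (@le_trans _ _ (expR (1 / 5) ^+ 10)); first by rewrite lerXn2r// nnegrE ?expR_ge0//; lra.
    by rewrite -expRM_natl ler_expR; lra.
  lra.
lra.
Qed.
End noise_events.

Lemma measurable_welsch_score (R : realType) (tau : R) :
  measurable_fun setT (welsch_score tau).
Proof.
apply: measurable_funM => //; apply: measurableT_comp => //.
by apply: measurable_funM => //; exact: measurable_funX.
Qed.

(* Conditionally on the noise the score is a sum of independent sub-Gaussian
   variables, so that subtracting half its conditional variance proxy leaves an
   exponential moment at most [1]. *)
Lemma score_event d (T : measurableType d) (R : realType) (P : probability T R)
    (n p : nat) (X : T -> 'M[R]_(n, p)) (xi : T -> 'cV[R]_n) (s : seq 'cV[R]_p)
    (M la tau u : R) :
  random_mx X -> random_mx xi ->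
  indep_pair P (X : T -> borel_mx R n p) (xi : T -> borel_mx R n 1) ->
  subgaussian_design P X ->
  (forall v, v \in s -> enorm v <= 1) -> (size s)%:R <= expR M ->
  exists B, [/\ measurable B, (P B <= (expR (- u))%:E)%E &
    forall w, ~ B w -> forall v, v \in s ->
      la * \sum_i welsch_score tau (xi w i 0) * dotc (design_row (X w) i) v <=
      la ^+ 2 / 2 * \sum_i welsch_score tau (xi w i 0) ^+ 2 + M + u].
Proof.
move=> mX mxi ind sX s1 sM.
pose g (x : 'M[R]_(n, p)) (y : 'cV[R]_n) (v : 'cV[R]_p) (i : 'I_n) : R :=
  la * (welsch_score tau (y i 0) * dotc (design_row x i) v)
    - la ^+ 2 / 2 * welsch_score tau (y i 0) ^+ 2.
have mF v : measurable_fun setT (fun z : borel_mx R n p * borel_mx R n 1 =>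
    \sum_i g z.1 z.2 v i).
  apply: measurable_sum => i.
  have my : measurable_fun setT (fun z : borel_mx R n p * borel_mx R n 1 => welsch_score
      tau (z.2 i 0)).
    apply: measurableT_comp; first exact: measurable_welsch_score.
    exact: (measurableT_comp (@measurable_coord R n 1 i 0) measurable_snd).
  have mx : measurable_fun setT (fun z : borel_mx R n p * borel_mx R n 1 => dotc
      (design_row z.1 i) v).
    apply: (@measurable_dotc _ (borel_mx R n p * borel_mx R n 1)%type).
    exact: (@measurable_design_row _ (borel_mx R n p * borel_mx R n 1)%type _ _ _ fst i
        measurable_fst).
  apply: measurable_funB; apply: measurable_funM => //; first exact: measurable_funM.
  exact: measurable_funX.
have [|v vs|B [mB PB HB]] := @exp_moment_seq _ T R P _ s
    (fun v w => \sum_i g (X w) (xi w) v i) 0 M u _ _ sM.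
- move=> v; exact: (measurableT_comp (mF v) (measurable_fun_pair mX mxi)).
- apply: (@indep_pair_integral_le _ T R P _ (borel_mx R n p) _ (borel_mx R n 1) X xi
    (fun z => expR (\sum_i g z.1 z.2 v i))) => //.
    by apply: measurableT_comp => //; exact: mF.
  move=> y /=; have [[indX _] _ _ _] := sX.
  have := @integral_expR_sum_le _ T R P _ (borel_mx R p 1) 'I_n
    (fun i w => design_row (X w) i)
    (fun i x => la * (welsch_score tau (y i 0) * dotc x v)
       - la ^+ 2 / 2 * welsch_score tau (y i 0) ^+ 2) (fun _ => 0) indX.
  rewrite big1//; apply.
  + by move=> i; exact: measurable_design_row.
  + move=> i; apply: measurable_funB => //; apply: measurable_funM => //; apply:
      measurable_funM => //.
    exact: (@measurable_dotc _ (borel_mx R p 1)).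
  + move=> i; set z := welsch_score tau _.
    under eq_integral do rewrite mulrA expRD mulrC EFinM.
    rewrite ge0_integralZl//; last first.
      apply/measurable_EFinP; apply: measurableT_comp => //; apply: measurable_funM => //.
      by apply: measurable_dotc; exact: measurable_design_row.
    apply: (@le_trans _ _ ((expR (- (la ^+ 2 / 2 * z ^+ 2)))%:E * (expR ((la * z) ^+ 2 / 2))%:E)%E).
      apply: lee_wpmul2l; first by rewrite lee_fin expR_ge0.
      by apply: design_mgf => //; exact: s1.
    by rewrite -EFinM -expRD lee_fin ler_expR [(la * z) ^+ 2]exprMn; lra.
exists B; split => // w Bw v vs; have := HB w Bw v vs.
rewrite /g sumrB -!big_distrr/=; lra.
Qed.

(** * The estimator on the good event *)

Section rates.
Context (R : realType) (n p o : nat) (L C il : R).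
Hypotheses (n0 : (0 < n)%N) (L0 : 0 < L) (C0 : 0 < C) (il0 : 0 <= il)
  (il2 : il <= 1 / 2) (oLn : o%:R + L <= n%:R).
Let x : R := o%:R / n%:R.
Let tau : R := C * ((o%:R + L) / n%:R) `^ (2 * il).

Let n0' : (0 : R) < n%:R. Proof. by rewrite ltr0n. Qed.
Let oL0 : 0 < o%:R + L. Proof. by rewrite ltr_wpDl. Qed.
Let w0 : 0 < (o%:R + L) / n%:R. Proof. by rewrite divr_gt0. Qed.
Let w1 : (o%:R + L) / n%:R <= 1. Proof. by rewrite ler_pdivrMr// mul1r. Qed.

Lemma tau_gt0 : 0 < tau.
Proof. by rewrite mulr_gt0// powR_gt0. Qed.

Lemma tau_le : tau <= C.
Proof.
rewrite -[leRHS]mulr1 ler_pM2l// -[leRHS](powRr0 ((o%:R + L) / n%:R)).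
by apply: ger_powR; rewrite ?w0 ?w1// mulr_ge0.
Qed.

(** A ratio in [(0, 1]] does not decrease when raised to the power [2 il <= 1]; this is where
    [l >= 2] enters. *)
Lemma tau_ge_linear : C * (o%:R + L) <= tau * n%:R.
Proof.
rewrite -ler_pdivrMr// -mulrA ler_pM2l// -[leLHS]powRr1; last exact: ltW.
have il21 : 2 * il <= 1 by have := il2; lra.
by apply: ger_powR => //; rewrite w0 w1.
Qed.

Lemma tau_ge_powR : C * x `^ (2 * il) <= tau.
Proof.
rewrite ler_pM2l//; apply: ge0_ler_powR; rewrite ?nnegrE ?mulr_ge0 ?invr_ge0 ?addr_ge0
    ?(ltW L0) ?(ltW n0')//.
by rewrite ler_pM2r ?invr_gt0// lerDl ltW.
Qed.

(** The squared outlier cost: dividing by [tau] lowers the exponent [2] to [2 (1 - 1/l)]. The case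
    [x = 0] is apart because exponents add only for a non-zero base. *)
Lemma sqr_ratio_le : x ^+ 2 / tau <= (x `^ (1 - il)) ^+ 2 / C.
Proof.
have [x0|xn] := eqVneq x 0.
  by rewrite x0 expr0n mul0r mulr_ge0 ?invr_ge0 ?sqr_ge0// ltW.
have xp : 0 < x by rewrite lt_def xn mulr_ge0// invr_ge0.
have e : (x `^ (1 - il)) ^+ 2 * x `^ (2 * il) = x ^+ 2.
  rewrite -powR_mulrn ?powR_ge0// -powRrM -powRD; last by rewrite xn implybT.
  by rewrite -powR_mulrn ?ltW//; congr (_ `^ _); ring.
rewrite ler_pdivrMr ?tau_gt0// mulrAC ler_pdivlMr// -e -mulrA ler_wpM2l ?sqr_ge0//.
by rewrite mulrC tau_ge_powR.
Qed.

(** The product under the second root splits in two: the part in [ln (n / o) + K] follows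
    [sqr_ratio_le] to the first term of the rate, and in the part with [W] the factor
    [x / tau <= 1 / C] leaves only [(p + L) / n]. *)
Lemma welsch_rate_bound (l : \bar R) (delta K M' a W : R) :
  il = inv_exponent l -> L = ln (1 / delta) ->
  1 <= K -> 1 <= M' -> 0 <= a -> 0 <= W -> W <= M' * (p%:R + L) ->
  2 * o%:R <= n%:R :> R -> 2 * L <= n%:R ->
  n%:R^-1 * (a * Num.sqrt (n%:R * (p%:R + L)) +
     Num.sqrt (o%:R * (4 / tau) * (4 * (o%:R * (4 * ln (n%:R / o%:R)) + 4 * (K * o%:R + W)))))
  <= (a + 8 / Num.sqrt C * (Num.sqrt (1 + K) + Num.sqrt M')) * welsch_rate n p o l delta.
Proof.
move=> ilE LE K1 M1 a0 W0 WM o2 L2.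
rewrite /welsch_rate -ilE -LE -/x.
set ell := ln (expR 1 * n%:R / (2 * o%:R)).
set b1 := x `^ (1 - il) * Num.sqrt ell.
set b2 := Num.sqrt (p%:R / n%:R).
set b3 := Num.sqrt (L / n%:R * _).
have b10 : 0 <= b1 by rewrite mulr_ge0 ?powR_ge0 ?sqrtr_ge0.
have b20 : 0 <= b2 by exact: sqrtr_ge0.
have b30 : 0 <= b3 by exact: sqrtr_ge0.
have y0 : 0 <= L / n%:R by rewrite divr_ge0 ?ltW.
have z0 : 0 <= p%:R / n%:R :> R by rewrite divr_ge0.
have b2E : b2 ^+ 2 = p%:R / n%:R by rewrite sqr_sqrtr.
(* The logarithm of the last term is at least [1] because [2 L <= n]. *)
have b3E : L / n%:R <= b3 ^+ 2.
  have le1 : 1 <= ln (expR 1 * n%:R / (2 * L)).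
    rewrite -[leLHS]expRK -mulrA ler_ln ?posrE ?expR_gt0 ?mulr_gt0 ?expR_gt0 ?invr_gt0 ?mulr_gt0//.
    by rewrite ler_pMr ?expR_gt0// ler_pdivlMr ?mulr_gt0// mul1r.
  rewrite sqr_sqrtr; last by rewrite mulr_ge0//; lra.
  by rewrite -[leLHS]mulr1 ler_wpM2l.
have Qb : (p%:R + L) / n%:R <= (b2 + b3) ^+ 2.
  by rewrite mulrDl sqrrD b2E; have := mulr_ge0 b20 b30; lra.
have le1st : n%:R^-1 * Num.sqrt (n%:R * (p%:R + L)) <= b2 + b3.
  rewrite -(@ler_pXn2r _ 2)// ?nnegrE ?mulr_ge0 ?invr_ge0 ?sqrtr_ge0 ?addr_ge0//.
  have nQ0 : 0 <= n%:R * (p%:R + L) by rewrite mulr_ge0// addr_ge0// ltW.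
  apply: le_trans Qb; rewrite exprMn (sqr_sqrtr nQ0).
  by rewrite le_eqVlt; apply/orP; left; apply/eqP; field; rewrite gt_eqF.
have sC : 0 < Num.sqrt C by rewrite sqrtr_gt0.
have sK := sqrtr_ge0 (1 + K); have sM := sqrtr_ge0 M'.
have t0 := tau_gt0.
have le2nd : n%:R^-1 * Num.sqrt (o%:R * (4 / tau) * (4 * (o%:R * (4 * ln (n%:R / o%:R)) + 4
    * (K * o%:R + W)))) <=
   8 / Num.sqrt C * (Num.sqrt (1 + K) * b1 + Num.sqrt M' * (b2 + b3)).
  have rhs0 : 0 <= 8 / Num.sqrt C * (Num.sqrt (1 + K) * b1 + Num.sqrt M' * (b2 + b3)).
    by rewrite mulr_ge0 ?divr_ge0 ?(ltW sC)// addr_ge0// mulr_ge0// addr_ge0.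
  have [zo|po] := posnP o.
    by rewrite zo !mul0r sqrtr0 mulr0 -/b1.
  have o0' : (0 : R) < o%:R by rewrite ltr0n.
  have x0 : 0 < x by rewrite divr_gt0.
  have lno : ln (n%:R / o%:R) <= ell.
    rewrite /ell ler_ln ?posrE ?divr_gt0 ?mulr_gt0 ?expR_gt0//.
    have -> : expR 1 * n%:R / (2 * o%:R) = n%:R / o%:R * (expR 1 / 2) :> R by field; rewrite gt_eqF.
    rewrite ler_pMr ?divr_gt0// ler_pdivlMr// mul1r.
    by have := @expR_ge1Dx R 1; lra.
  have ell1 : 1 <= ell.
    rewrite /ell -[leLHS]expRK -mulrA ler_ln ?posrE ?expR_gt0 ?mulr_gt0 ?expR_gt0 ?invr_gt0
        ?mulr_gt0//.
    by rewrite ler_pMr ?expR_gt0// ler_pdivlMr ?mulr_gt0// mul1r.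
  have b1E : b1 ^+ 2 = (x `^ (1 - il)) ^+ 2 * ell by rewrite exprMn sqr_sqrtr//; lra.
  rewrite -(@ler_pXn2r _ 2)// ?nnegrE ?mulr_ge0 ?invr_ge0 ?sqrtr_ge0//.
  have lhsE : (n%:R^-1 * Num.sqrt (o%:R * (4 / tau) * (4 * (o%:R * (4 * ln (n%:R / o%:R)) +
      4 * (K * o%:R + W))))) ^+ 2
      = 64 * (x ^+ 2 / tau * (ln (n%:R / o%:R) + K) + x / tau * (W / n%:R)).
    rewrite exprMn sqr_sqrtr.
      by rewrite /x; field; rewrite !gt_eqF.
    have ln0' : 0 <= ln (n%:R / o%:R) :> R.
      by rewrite ln_ge0// ler_pdivlMr// mul1r; lra.
    have K0 : 0 <= K by lra.
    apply: mulr_ge0; first by rewrite mulr_ge0// divr_ge0// ltW.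
    by rewrite mulr_ge0// addr_ge0// mulr_ge0// ?mulr_ge0// addr_ge0// mulr_ge0.
  rewrite lhsE; apply: (@le_trans _ _ (64 / C * ((1 + K) * b1 ^+ 2 + M' * (b2 + b3) ^+
      2))); last first.
    have -> : 64 / C * ((1 + K) * b1 ^+ 2 + M' * (b2 + b3) ^+ 2) =
      (8 / Num.sqrt C) ^+ 2 * ((Num.sqrt (1 + K) * b1) ^+ 2 + (Num.sqrt M' * (b2 + b3)) ^+ 2).
      have K10 : 0 <= 1 + K by lra.
      have M0 : 0 <= M' by lra.
      rewrite !exprMn exprVn (sqr_sqrtr (ltW C0)) (sqr_sqrtr K10) (sqr_sqrtr M0).
      by field; rewrite gt_eqF.
    rewrite [leRHS]exprMn ler_wpM2l ?sqr_ge0// [leRHS]sqrrD.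
    have := mulr_ge0 (mulr_ge0 sK b10) (mulr_ge0 sM (addr_ge0 b20 b30)).
    by move: (Num.sqrt (1 + K) * b1) (Num.sqrt M' * (b2 + b3)) => u v; lra.
  have C0i : 0 < C^-1 by rewrite invr_gt0.
  have t1 : x ^+ 2 / tau * (ln (n%:R / o%:R) + K) <= C^-1 * ((1 + K) * b1 ^+ 2).
    apply: (@le_trans _ _ ((x `^ (1 - il)) ^+ 2 / C * ((1 + K) * ell))).
      apply: ler_pM.
      - by rewrite mulr_ge0 ?sqr_ge0// invr_ge0 ltW.
      - by rewrite addr_ge0//; [rewrite ln_ge0// ler_pdivlMr// mul1r; lra|lra].
      - exact: sqr_ratio_le.
      - have K0 : 0 <= K by lra.
        by have := ler_wpM2l K0 ell1; lra.
    by rewrite b1E le_eqVlt; apply/orP; left; apply/eqP; ring.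
  have t2 : x / tau * (W / n%:R) <= C^-1 * (M' * (b2 + b3) ^+ 2).
    apply: ler_pM.
    - by rewrite divr_ge0// ltW.
    - by rewrite divr_ge0// ltW.
    - rewrite ler_pdivrMr// mulrC ler_pdivlMr// /x mulrAC ler_pdivrMr//.
      apply: le_trans tau_ge_linear; rewrite mulrC ler_pM2l//; have := L0; lra.
    - apply: (@le_trans _ _ (M' * ((p%:R + L) / n%:R))).
        by rewrite mulrA ler_pM2r ?invr_gt0.
      by rewrite ler_wpM2l//; lra.
  by move: t1 t2; lra.
have le1st' := ler_wpM2l a0 le1st.
apply: (@le_trans _ _ (a * (b2 + b3) + 8 / Num.sqrt C * (Num.sqrt (1 + K) * b1 + Num.sqrt
    M' * (b2 + b3)))).
  rewrite [leLHS]mulrDr; apply: lerD; last exact: le2nd.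
  by rewrite mulrCA.
rewrite [leRHS]mulrDl; apply: lerD; first by rewrite ler_wpM2l//; lra.
rewrite -[leRHS]mulrA ler_wpM2l ?divr_ge0 ?(ltW sC)//.
have := mulr_ge0 sK b20; have := mulr_ge0 sK b30; have := mulr_ge0 sM b10.
by rewrite -[Num.sqrt (1 + K)]/(Num.sqrt (1 + K)); move: (Num.sqrt (1 + K)) (Num.sqrt M')
    => u v; lra.
Qed.

End rates.

(** * Deterministic consequences of the random events *)

Section good_event.
Context (R : realType) (n p o : nat) (X : 'M[R]_(n, p)) (theta xi : 'cV[R]_n)
  (bstar : 'cV[R]_p) (s : seq 'cV[R]_p).
(** Here [e] is the mesh of the net, [W] the joint price of its entropy and of the confidence level,
    [ep] the tolerated fraction of harmful rows, [kap] their share of the quadratic form and [t1]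
    the truncation level that enforces this share. *)
Variables (e c K W M' L C il ep t1 kap delta : R) (l : \bar R).
Let q i u := dotc (design_row X i) u.
Let Y := response X theta xi bstar.
Let tau : R := C * ((o%:R + L) / n%:R) `^ (2 * il).
Let K2 : R := 16 * (K + 1).
Let Q : R := p%:R + L.
Let clip (x : R) := Num.min 1 (tau * x ^+ 2).

Hypotheses (n0 : (0 < n)%N) (L0 : 0 < L) (C0 : 0 < C) (il0 : 0 <= il)
  (il2 : il <= 1 / 2) (c0 : 0 <= c) (c1 : c <= 1) (K1 : 1 <= K) (M1 : 1 <= M')
  (ep0 : 0 < ep) (t10 : 0 <= t1) (W0 : 0 <= W) (WQ : W <= M' * Q).
Hypotheses (cs : covers_ball e s) (e0 : 0 <= e) (e4 : e <= 1 / 4)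
  (eK : e * Num.sqrt K2 <= 1 / 4).
Hypotheses (kap0 : 0 < kap) (kap502 : 502 * kap <= 1 / 16)
  (t1K : 64 * K * expR (- t1 / 4) <= kap)
  (ept1 : 16 * ep * t1 <= kap) (Cep : 4 * (16 * 20 + 32 * K2) * C <= ep).
Hypotheses (oLn : o%:R + L <= n%:R) (o2 : 2 * o%:R <= n%:R :> R) (L2 : 2 * L <= n%:R)
  (nW : 16 * (512 * K) * W <= n%:R) (nW' : 64 * W <= kap * n%:R)
  (no : 4 * o%:R <= ep * n%:R) (nL : 4 * (16 * 12) * L <= ep * n%:R).
Hypothesis sparse : (\sum_(i < n) (theta i 0%R != 0%R) <= o)%N.
Hypothesis lower : let la := (512 * K)^-1 in forall v, v \in s ->
  la * (n%:R * enorm v ^+ 2) <=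
    la * \sum_i q i v ^+ 2 + (n%:R * (la ^+ 2 * (32 * K)) + W).
(* The threshold [0] controls the whole quadratic form, [t1] the one restricted to
   [ep n] rows and [4 ln (n / o)] the one restricted to [o] rows. *)
Hypothesis excess : forall t, t \in [:: 0; t1; 4 * ln (n%:R / o%:R)] ->
  forall v, v \in s ->
  \sum_i Num.max (q i v ^+ 2 - t) 0 <= 4 * (n%:R * (K * expR (- t / 4)) + W).
(** As the energy of the score is of order [n] and [W] of order [Q], this [la] balances the two
    terms on the right. *)
Hypothesis score : let la := Num.sqrt (Q / n%:R) in forall v, v \in s ->
  la * \sum_i welsch_score tau (xi i 0) * q i v <=
    la ^+ 2 / 2 * \sum_i welsch_score tau (xi i 0) ^+ 2 + W.
Hypothesis noise : \sum_i clip (xi i 0) <= 20 * n%:R * tau + 12 * L.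

Let n0' : (0 : R) < n%:R. Proof. by rewrite ltr0n. Qed.
Let e2 : e <= 1 / 2. Proof. by have := e4; lra. Qed.
Let Q0 : 0 < Q. Proof. by rewrite ltr_wpDl. Qed.
Let K20 : 0 <= K2. Proof. by have := K1; rewrite /K2; lra. Qed.
Let tau0 : 0 < tau. Proof. exact: tau_gt0. Qed.

(** At threshold [0] the excess is the full form; a factor [4] from the net, another from the excess
    bound and [W <= n] give [K2]. *)
Lemma good_upper_form u : \sum_i q i u ^+ 2 <= K2 * n%:R * enorm u ^+ 2.
Proof.
have k1 : kap <= 1 by have := kap502; lra.
have n1 : W <= n%:R by have := W0; have := nW'; have := ler_wpM2r (ltW n0') k1; lra.
have E0 : 0 <= 4 * (n%:R * (K * expR (- 0 / 4)) + W).
  by rewrite mulr_ge0// addr_ge0// mulr_ge0// mulr_ge0 ?expR_ge0//; have := K1; lra.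
have := @net_sparse_forms R n p X s e 0 _ cs e2 (lexx _) E0 (excess (mem_head _ _)) [set: 'I_n] u.
rewrite (eq_bigl xpredT); last by move=> i; rewrite inE.
move=> /le_trans; apply; rewrite ler_wpM2r ?sqr_ge0// mulr0 add0r oppr0 mul0r expR0.
by rewrite /K2; lra.
Qed.

(** For [la = (512 K)^-1] the second-order error is [n / 16] and [W / la] is at most [n / 16];
    together they stay below [n |v|^2 / 2] when [|v|^2 >= 1 / 4]. *)
Lemma good_lower_form u : 1 / 16 * n%:R * enorm u ^+ 2 <= \sum_i q i u ^+ 2.
Proof.
apply: (net_lower_form n0 cs e0 e4 K20 eK) => // [v vs v2|]; last exact: good_upper_form.
have K0 : 0 < 512 * K by have := K1; lra.
have := lower vs; set la := (512 * K)^-1 => h.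
have la0 : 0 < la by rewrite invr_gt0.
have laK : la * (512 * K) = 1 := mulVf (lt0r_neq0 K0).
have {}h : n%:R * enorm v ^+ 2 <= \sum_i q i v ^+ 2 + n%:R / 16 + 512 * K * W.
  rewrite -(ler_pM2l la0); apply: (le_trans h); rewrite le_eqVlt; apply/orP; left; apply/eqP.
  have -> : la ^+ 2 * (32 * K) = la * (la * (512 * K)) / 16 by field.
  have e3 : la * (512 * K * W) = W by rewrite mulrA laK mul1r.
  by rewrite laK -[in LHS]e3; field.
have v4 : 1 / 4 <= enorm v ^+ 2.
  by have := mulr_ge0 (enorm_ge0 v) (enorm_ge0 v); nra.
have := ler_wpM2l (ltW n0') v4; have := nW; move=> *; lra.
Qed.

(** The truncated part, the excess and the deviation [W] each take at most a quarter of [kap n]. *)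
Lemma good_small_form u (S : {set 'I_n}) : #|S|%:R <= ep * n%:R ->
  \sum_(i in S) q i u ^+ 2 <= kap * n%:R * enorm u ^+ 2.
Proof.
move=> Sep.
have K0 : 0 <= K by have := K1; lra.
have E0 : 0 <= 4 * (n%:R * (K * expR (- t1 / 4)) + W).
  by rewrite mulr_ge0// addr_ge0// mulr_ge0// mulr_ge0 ?expR_ge0.
have h : t1 \in [:: 0; t1; 4 * ln (n%:R / o%:R)] by rewrite !inE eqxx orbT.
have := @net_sparse_forms R n p X s e t1 _ cs e2 t10 E0 (excess h) S u.
move=> /le_trans; apply; rewrite ler_wpM2r ?sqr_ge0//.
have h1 := ler_wpM2r t10 Sep.
have h2 := ler_wpM2l (ltW n0') t1K.
have h3 := ler_wpM2l (ltW n0') ept1.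
have h4 := nW'.
have n1 := mulr_ge0 (ltW kap0) (ltW n0'); move: (expR _) h2 => E h2; lra.
Qed.

(** The threshold [4 ln (n / o)] is the one at which the mean excess [n K expR (- t / 4)] drops to
    [K o]. *)
Lemma good_outlier_form u (S : {set 'I_n}) : (0 < o)%N -> (#|S| <= o)%N ->
  \sum_(i in S) q i u ^+ 2 <=
    4 * (o%:R * (4 * ln (n%:R / o%:R)) + 4 * (K * o%:R + W)) * enorm u ^+ 2.
Proof.
move=> po So; have o0' : (0 : R) < o%:R by rewrite ltr0n.
have K0 : 0 <= K by have := K1; lra.
set t := 4 * ln (n%:R / o%:R).
have t0 : 0 <= t.
  by rewrite mulr_ge0// ln_ge0// ler_pdivlMr// mul1r; have := L0; have := oLn; lra.
have E0 : 0 <= 4 * (n%:R * (K * expR (- t / 4)) + W).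
  by rewrite mulr_ge0// addr_ge0// mulr_ge0// mulr_ge0 ?expR_ge0.
have h : t \in [:: 0; t1; 4 * ln (n%:R / o%:R)] by rewrite !inE eqxx !orbT.
have := @net_sparse_forms R n p X s e t _ cs e2 t0 E0 (excess h) S u.
move=> /le_trans; apply; rewrite ler_wpM2r ?sqr_ge0//.
have -> : expR (- t / 4) = o%:R / n%:R.
  rewrite (_ : - t / 4 = - ln (n%:R / o%:R)); last by rewrite /t; field.
  by rewrite expRN lnK ?invf_div// posrE divr_gt0.
have -> : n%:R * (K * (o%:R / n%:R)) = K * o%:R by field; rewrite gt_eqF.
have : #|S|%:R * t <= o%:R * t by rewrite ler_wpM2r// ler_nat.
by move=> h1; lra.
Qed.

Let K5 : R := 20 + 12 / C.

Lemma good_score u : \sum_i welsch_score tau (xi i 0) * q i u <=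
  2 * (M' + K5 / 2) * Num.sqrt (n%:R * Q) * enorm u.
Proof.
(* The linear form is represented by a vector, so [net_dual] extends the bound from the net to all
   directions. *)
pose w : 'cV[R]_p := \sum_i welsch_score tau (xi i 0) *: design_row X i.
have wE v : dotc w v = \sum_i welsch_score tau (xi i 0) * q i v.
  rewrite /w; elim/big_ind2: _ => [|a b x y <- <-|i _]; last by rewrite dotcZl.
    by rewrite /dotc big1// => j _; rewrite mxE mul0r.
  by rewrite dotcDl.
have psi2 : \sum_i welsch_score tau (xi i 0) ^+ 2 <= K5 * n%:R.
  rewrite -(ler_pM2l tau0) big_distrr/=.
  apply: (@le_trans _ _ (\sum_i clip (xi i 0))).
    by apply: ler_sum => i _; exact: sqr_welsch_score_le.
  apply: (le_trans noise).
  have hL : L <= tau * n%:R / C.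
    rewrite ler_pdivlMr// mulrC; apply: le_trans (tau_ge_linear _ _ _ _ _) => //.
    by rewrite ler_pM2l// lerDr.
  by rewrite /K5; lra.
have sc := score; set la := Num.sqrt (Q / n%:R) in sc.
have la0 : 0 < la by rewrite sqrtr_gt0 divr_gt0.
have la2 : la ^+ 2 = Q / n%:R by rewrite sqr_sqrtr ?divr_ge0// ltW.
have sq : Num.sqrt (n%:R * Q) = n%:R * la.
  have -> : n%:R * Q = n%:R ^+ 2 * (Q / n%:R) by field; rewrite gt_eqF.
  by rewrite sqrtrM ?sqr_ge0// sqrtr_sqr ger0_norm.
have wn : enorm w <= 2 * ((M' + K5 / 2) * Num.sqrt (n%:R * Q)).
  have cs2 : covers_ball (1 / 2) s.
    by move=> v v1; have [z zs vz] := cs v1; exists z => //; apply: le_trans vz e2.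
  apply: net_dual cs2 _ => v vs.
  rewrite -(ler_pM2l la0) wE; apply: (le_trans (sc v vs)).
  rewrite sq la2.
  have -> : la * ((M' + K5 / 2) * (n%:R * la)) = la ^+ 2 * n%:R * (M' + K5 / 2) by ring.
  rewrite la2 divfK ?gt_eqF//.
  have := ler_wpM2l (ltW Q0) psi2.
  have -> : Q / n%:R / 2 * (\sum_i welsch_score tau (xi i 0) ^+ 2) =
     Q * (\sum_i welsch_score tau (xi i 0) ^+ 2) / (2 * n%:R) by field; rewrite gt_eqF.
  move=> h; have : Q * (\sum_i welsch_score tau (xi i 0) ^+ 2) / (2 * n%:R) <= Q * K5 / 2.
    by rewrite ler_pdivrMr ?mulr_gt0//; lra.
  have := WQ; lra.
rewrite -wE; apply: le_trans (cauchy_schwarz _ _) _.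
by rewrite ler_wpM2r ?enorm_ge0// -mulrA.
Qed.

Lemma welsch_score_sqr_bound r : welsch_score tau r ^+ 2 <= 1 / tau.
Proof.
rewrite ler_pdivlMr// mulrC; apply: le_trans (sqr_welsch_score_le _ tau0) _.
by rewrite ge_min lexx.
Qed.

Lemma good_gradient u :
  n%:R^-1 * \sum_i welsch_score tau (residual X Y bstar i) * q i u <=
  n%:R^-1 * (2 * (M' + K5 / 2) * Num.sqrt (n%:R * Q) +
    Num.sqrt (o%:R * (4 / tau) * (4 * (o%:R * (4 * ln (n%:R / o%:R)) + 4 * (K * o%:R + W)))))
  * enorm u.
Proof.
rewrite -mulrA ler_wpM2l ?invr_ge0//.
have rE i : residual X Y bstar i = theta i 0 + xi i 0.
  by rewrite residualE subrr -(scale0r (0 : 'cV[R]_p)) dotcZr mul0r subr0.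
pose S := [set i | theta i 0 != 0]%SET.
have So : (#|S| <= o)%N.
  by apply: leq_trans sparse; rewrite -sum1dep_card big_mkcond; apply: leq_sum => i _; case: ifP.
(* Dropping the contaminated rows from the noise score would make it depend on the adversary; they
   are kept and corrected by [a]. *)
pose a i := welsch_score tau (theta i 0 + xi i 0) - welsch_score tau (xi i 0).
have -> : \sum_i welsch_score tau (residual X Y bstar i) * q i u =
   \sum_i welsch_score tau (xi i 0) * q i u + \sum_(i in S) a i * q i u.
  rewrite [X in _ = _ + X]big_mkcond -big_split; apply: eq_bigr => i _ /=.
  rewrite rE inE; case: ifPn => [_|/negPn/eqP ->]; first by rewrite /a; ring.
  by rewrite add0r addr0.
rewrite mulrDl; apply: lerD; first exact: good_score.
(* For [o = 0] the ratio [n / o] is a default value and [good_outlier_form] does not apply, but no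
   row is contaminated. *)
have [zo|po] := posnP o.
  have -> : S = finset.set0.
    by apply/eqP; rewrite -finset.cards_eq0 -leqn0 -zo.
  by rewrite big_set0 mulr_ge0 ?sqrtr_ge0 ?enorm_ge0.
have o0' : (0 : R) < o%:R by rewrite ltr0n.
set D := 4 * (_ + _).
have D0 : 0 <= D.
  have K0 : 0 <= K by have := K1; lra.
  rewrite mulr_ge0// addr_ge0// mulr_ge0//.
    by rewrite mulr_ge0// ln_ge0// ler_pdivlMr// mul1r; have := L0; have := oLn; lra.
  by rewrite addr_ge0// mulr_ge0.
have B0 : 0 <= 4 / tau by rewrite divr_ge0// ltW.
have aB i : i \in S -> a i ^+ 2 <= 4 / tau.
  move=> _; have := welsch_score_sqr_bound (theta i 0 + xi i 0).
  have := welsch_score_sqr_bound (xi i 0); rewrite /a.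
  move: (welsch_score _ _) (welsch_score _ _) => x y.
  by have := sqr_ge0 (x + y); nra.
apply: le_trans (sparse_linear_form B0 D0 aB (good_outlier_form u po So)) _.
apply: ler_wpM2r; first exact: enorm_ge0.
rewrite ler_sqrt; last by rewrite mulr_ge0// mulr_ge0.
by apply: ler_wpM2r => //; apply: ler_wpM2r => //; rewrite ler_nat.
Qed.

Lemma good_event_conclusion : il = inv_exponent l -> L = ln (1 / delta) ->
  exists2 bhat, forall b,
    minimizer_over (welsch_loss tau X Y) (basin bstar c) b <-> b = bhat &
    enorm (bhat - bstar) <=
      160 * (2 * (M' + K5 / 2) + 8 / Num.sqrt C * (Num.sqrt (1 + K) + Num.sqrt M'))
        * welsch_rate n p o l delta.
Proof.
move=> ilE LE.
have K50 : 0 <= 2 * (M' + K5 / 2).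
  rewrite mulr_ge0// addr_ge0//; first by have := M1; lra.
  by rewrite divr_ge0// /K5 addr_ge0// divr_ge0// ltW.
set g := n%:R^-1 * (2 * (M' + K5 / 2) * Num.sqrt (n%:R * Q) +
    Num.sqrt (o%:R * (4 / tau) * (4 * (o%:R * (4 * ln (n%:R / o%:R)) + 4 * (K * o%:R + W))))).
have g0 : 0 <= g.
  by rewrite mulr_ge0 ?invr_ge0// addr_ge0 ?sqrtr_ge0// mulr_ge0 ?sqrtr_ge0.
have gr : g <= (2 * (M' + K5 / 2) + 8 / Num.sqrt C * (Num.sqrt (1 + K) + Num.sqrt M')) *
    welsch_rate n p o l delta.
  exact: welsch_rate_bound.
have tC : tau <= C by exact: tau_le.
(* The outliers, the deviation in [L] and all terms in [tau <= C] take at most a quarter of [ep n]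
   each. *)
have Hm : \sum_i (theta i 0 != 0)%:R
  + 16 * \sum_i Num.min 1 (tau * xi i 0 ^+ 2) + 32 * tau * K2 * n%:R * c ^+ 2 <= ep * n%:R.
  have h1 : \sum_i (theta i 0 != 0)%:R <= o%:R :> R by rewrite -natr_sum ler_nat.
  have h2 := noise.
  have h3 : tau * n%:R <= C * n%:R by rewrite ler_wpM2r// ltW.
  have h4 : K2 * (tau * n%:R) * c ^+ 2 <= K2 * (C * n%:R).
    have cc : c ^+ 2 <= 1 by rewrite expr_le1.
    have a0 : 0 <= K2 * (tau * n%:R) by rewrite mulr_ge0// mulr_ge0// ltW.
    by have := ler_wpM2l a0 cc; have := ler_wpM2l K20 h3; lra.
  have h5 := ler_wpM2r (ltW n0') Cep.
  have h6 : 0 <= ep * n%:R by rewrite mulr_ge0// ltW.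
  have := no; have := nL; rewrite /clip in h2; lra.
have sc := @welsch_strong_convexity R n p X theta xi bstar tau c (1 / 16) kap K2 (ep * n%:R)
  tau0 n0 c0 K20 good_lower_form good_upper_form good_small_form kap502 Hm.
have k0 : (0 : R) < 1 / 16 / 10 by lra.
have [||bhat hb hd] := @strongly_convex_minimizer R p (welsch_loss tau X Y)
  (fun b u => n%:R^-1 * \sum_i welsch_score tau (residual X Y b i) * q i u) bstar c
  (1 / 16 / 10) g (@welsch_loss_continuous R n p tau X Y) c0 k0 g0 _ _ good_gradient.
- move=> b u; rewrite -mulrN -sumrN; congr (_ * _); apply: eq_bigr => i _.
  by rewrite /q dotcNr mulrN.
- by move=> b b' Sb Sb'; exact: sc.
exists bhat => //; apply: (le_trans hd).
(* The factor [160] is the inverse of the convexity constant [1 / 16 / 10]. *)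
rewrite -mulrA ler_pdivrMr//; lra.
Qed.

End good_event.

(** * Choice of the constants, union bound and conclusion *)

Lemma inv_exponent_bounds (R : realType) (l : \bar R) : (2%:E <= l)%E ->
  0 <= inv_exponent l <= 1 / 2.
Proof.
case: l => [r| |] //=; rewrite ?lee_fin => h; last by apply/andP; split => //; lra.
have r0 : 0 < r by lra.
by rewrite invr_ge0 ltW//= div1r lef_pV2 ?posrE.
Qed.

(** Sparsity holds almost surely and fails on a set known only to be negligible; a measurable null
    set around it yields the measurable event of [with_prob_ge]. *)
Lemma with_prob_ge_avoid d (T : measurableType d) (R : realType)
    (P : probability T R) (delta : R) (k : nat) (B : nat -> set T) (N G : set T) :
  (0 < k)%N ->
  (forall i, (i < k)%N -> measurable (B i) /\ (P (B i) <= (delta / k%:R)%:E)%E) ->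
  P.-negligible N ->
  (forall w, ~ N w -> (forall i, (i < k)%N -> ~ B i w) -> G w) ->
  with_prob_ge P (1 - delta) G.
Proof.
move=> k0 HB [N' [mN' PN' NN']] H.
have mU j : (j <= k)%N -> measurable (\big[setU/set0]_(i < j) B i).
  by move=> jk; apply: bigsetU_measurable => i _; apply: (HB _ _).1; exact: leq_trans jk.
pose U := \big[setU/set0]_(i < k) B i.
have PU : (P U <= delta%:E)%E.
  have : forall j, (j <= k)%N ->
      (P (\big[setU/set0]_(i < j) B i) <= (j%:R * (delta / k%:R))%:E)%E.
    elim=> [|j IH] jk; first by rewrite big_ord0 measure0 mul0r.
    rewrite big_ord_recr/=; have [mBj PBj] := HB j jk.
    apply: (le_trans (measureU2 _ _ _)) => //; first by apply: mU; exact: ltnW.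
    rewrite -[j.+1%:R]natr1 mulrDl mul1r EFinD; apply: leeD => //.
    by apply: IH; exact: ltnW.
  move=> /(_ k (leqnn k)); rewrite mulrC divfK//.
  by rewrite pnatr_eq0 -lt0n.
have mU' : measurable U by exact: mU.
exists (~` (U `|` N')); split.
- by apply: measurableC; exact: measurableU.
- move=> w /= /not_orP[Uw Nw]; apply: H => [/NN' //|i iB Bi].
  by apply: Uw; rewrite /U -bigcup_mkord; exists i.
- rewrite probability_setC; last exact: measurableU.
  rewrite EFinB; apply: leeB => //; apply: (le_trans (measureU2 _ _ _)) => //.
  by rewrite [X in (_ + X)%E]PN' adde0.
Qed.

(** There is no circularity: [q] and [kap] come first, then [t1], then [ep], and [C] last, each from
    [K] and earlier choices. *)
Lemma basin_constants (R : realType) (K : R) : 1 <= K ->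
  exists (q : nat) (kap t1 ep C : R),
  [/\ (0 < q)%N, q%:R^-1 <= 1 / 4 :> R & q%:R^-1 * Num.sqrt (16 * (K + 1)) <= 1 / 4] /\
  [/\ 0 < kap, 502 * kap <= 1 / 16, 0 <= t1 & 64 * K * expR (- t1 / 4) <= kap] /\
  [/\ 0 < ep, 16 * ep * t1 <= kap, 0 < C & 4 * (16 * 20 + 32 * (16 * (K + 1))) * C <= ep].
Proof.
move=> K1.
have K20 : 0 <= 16 * (K + 1) by lra.
have [q qgt0 [q0 q4 qK]] : exists2 q : nat, (0 < q)%N &
    [/\ (0 : R) < q%:R, (4 : R) <= q%:R & 4 * Num.sqrt (16 * (K + 1)) <= q%:R].
  set r := 4 * Num.sqrt _; have r4 := truncnS_gt r.
  by exists (Num.truncn r).+4; rewrite ?ltr0n ?ler_nat//; split => //;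
      apply/ltW/(lt_le_trans r4); rewrite ler_nat ltnS -[leqRHS]addn3 leq_addr.
have q4' : q%:R^-1 <= 1 / 4 :> R by rewrite -[leLHS]div1r ler_pdivrMr//; lra.
have qK' : q%:R^-1 * Num.sqrt (16 * (K + 1)) <= 1 / 4 by rewrite mulrC ler_pdivrMr//; lra.
have [kap kap0 kap502] : exists2 kap : R, 0 < kap & 502 * kap <= 1 / 16.
  by exists ((16 * 502)^-1); lra.
have [t1 t10 t1K] : exists2 t1, 0 <= t1 & 64 * K * expR (- t1 / 4) <= kap.
  have K64 : 1 <= 64 * K / kap by rewrite ler_pdivlMr//; lra.
  exists (4 * ln (64 * K / kap)); first by rewrite mulr_ge0// ln_ge0.
  rewrite (_ : - _ / 4 = - ln (64 * K / kap)); last by field.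
  rewrite expRN lnK ?posrE; last by lra.
  by rewrite invf_div mulrC divfK// gt_eqF//; lra.
have [ep ep0 ept1] : exists2 ep, 0 < ep & 16 * ep * t1 <= kap.
  exists (kap / (16 * t1 + 1)); first by rewrite divr_gt0//; lra.
  rewrite (_ : 16 * _ * t1 = 16 * kap * t1 / (16 * t1 + 1)); last by field; rewrite gt_eqF//; lra.
  by rewrite ler_pdivrMr; nra.
have [C C0 Cep] : exists2 C, 0 < C & 4 * (16 * 20 + 32 * (16 * (K + 1))) * C <= ep.
  have : 0 < 4 * (16 * 20 + 32 * (16 * (K + 1))).
    by rewrite mulr_gt0// ltr_wpDr// mulr_ge0.
  move: (4 * _) => z z0; exists (ep / z); first by rewrite divr_gt0.
  by rewrite mulrC divfK// gt_eqF.
by exists q, kap, t1, ep, C; do !split.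
Qed.

Lemma sample_size_bounds (R : realType) (n p o : nat) (K M' kap ep C1 L W : R) :
  1 <= K -> 1 <= M' -> 0 < kap -> 0 < ep -> 0 < L -> W <= M' * (p%:R + L) ->
  2 <= C1 -> 16 * (512 * K) * M' <= C1 -> 64 / kap * M' <= C1 ->
  4 * (16 * 12) / ep <= C1 -> C1 * (o%:R + L + p%:R) <= n%:R ->
  [/\ o%:R + L <= n%:R, 2 * o%:R <= n%:R :> R & 2 * L <= n%:R] /\
  [/\ 16 * (512 * K) * W <= n%:R, 64 * W <= kap * n%:R, 4 * o%:R <= ep * n%:R
    & 4 * (16 * 12) * L <= ep * n%:R].
Proof.
move=> K1 M'1 kap0 ep0 L0 WQ C1_2 C1_K C1_kap C1_ep nC.
have o0 : 0 <= o%:R :> R by [].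
have p0 : 0 <= p%:R :> R by [].
have S0 : 0 <= o%:R + L + p%:R by rewrite !addr_ge0// ltW.
have nk k : k <= C1 -> k * (o%:R + L + p%:R) <= n%:R.
  by move=> kC; apply: le_trans nC; rewrite ler_wpM2r.
have n2 := nk 2 C1_2.
have pLS : p%:R + L <= o%:R + L + p%:R by lra.
have WS : W <= M' * (o%:R + L + p%:R).
  by apply: (le_trans WQ); rewrite ler_wpM2l//; lra.
have nW : 16 * (512 * K) * W <= n%:R.
  apply: le_trans (nk _ C1_K); rewrite -[leRHS]mulrA.
  by apply: ler_wpM2l; [lra|exact: WS].
have nW' : 64 * W <= kap * n%:R.
  rewrite -ler_pdivrMl// mulrC mulrAC; apply: le_trans (nk _ C1_kap).
  by rewrite -[leRHS]mulrA ler_wpM2l// divr_ge0// ltW.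
have nep : 4 * (16 * 12) * (o%:R + L + p%:R) <= ep * n%:R.
  by rewrite -ler_pdivrMl// mulrC mulrAC; exact: nk.
by split; split => //; lra.
Qed.

Theorem proposition2 (R : realType) (A : R) (hA : 0 < A) :
  exists2 c0 : R, 0 < c0 &
  forall c : R, 0 < c -> c <= c0 ->
  exists C C1 : R, [/\ 0 < C, 0 < C1 &
  forall (d : measure_display) (T : measurableType d) (P : probability T R)
         (n p o : nat) (bstar : 'cV[R]_p)
         (X : T -> 'M[R]_(n, p)) (theta xi Y : T -> 'cV[R]_n)
         (l : \bar R) (a delta : R),
    random_mx X -> random_mx theta -> random_mx xi ->
    (forall w, Y w = response (X w) (theta w) (xi w) bstar) ->
    indep_pair P (X : T -> borel_mx R n p) (xi : T -> borel_mx R n 1) ->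
    o_sparse P theta o ->
    subgaussian_design P X ->
    (2%:E <= l)%E -> 0 < a -> a <= A ->
    noise_assumption P xi l a ->
    0 < delta -> delta < 1 ->
    C1 * (o%:R + ln (1 / delta) + p%:R) <= n%:R ->
    with_prob_ge P (1 - delta)
      [set w | exists bhat : 'cV[R]_p,
         two_stage_converges (welsch_tau C n o l delta) (X w) (Y w) bstar c bhat
         /\ enorm (bhat - bstar) <= C1 * welsch_rate n p o l delta]].
Proof.
have [K K1 HK] := subgaussian_sqr_mgf R.
exists 1 => // c c0 c1.
have [q [kap [t1 [ep [C [[qgt0 q4 qK] [[kap0 kap502 t10 t1K] [ep0 ept1 C0 Cep]]]]]]]] :=
  basin_constants K1.
pose Mn : R := q%:R ^+ 2 + 2.
have Mn0 : 0 <= Mn by rewrite addr_ge0// sqr_ge0.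
have [M' M'E M'1] : exists2 M' : R, M' = Mn + 5 & 1 <= M' by exists (Mn + 5) => //; lra.
have [C2 C2E] : exists C2, C2 = 160 * (2 * (M' + (20 + 12 / C) / 2) + 8 / Num.sqrt C *
    (Num.sqrt (1 + K) + Num.sqrt M')) by eexists.
have C20 : 0 <= C2.
  have C12 : 0 <= 12 / C by rewrite divr_ge0 ?(ltW C0).
  have h1 : 0 <= 8 / Num.sqrt C by rewrite divr_ge0 ?sqrtr_ge0.
  have h2 := mulr_ge0 h1 (addr_ge0 (sqrtr_ge0 (1 + K)) (sqrtr_ge0 M')).
  by rewrite C2E; lra.
have [C1 [C1_2 C1_K C1_kap C1_ep C1_C2]] : exists C1 : R,
    [/\ 2 <= C1, 16 * (512 * K) * M' <= C1, 64 / kap * M' <= C1, 4 * (16 * 12) / ep <= C1 &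
        C2 <= C1].
  have h1 : 0 <= K * M' by rewrite mulr_ge0//; lra.
  have h2 : 0 <= 64 / kap * M' by rewrite mulr_ge0 ?divr_ge0 ?(ltW kap0)//; lra.
  have h3 : 0 <= 4 * (16 * 12) / ep by rewrite divr_ge0// ltW.
  by exists (2 + 16 * (512 * K) * M' + 64 / kap * M' + 4 * (16 * 12) / ep + C2); split; lra.
exists C, C1; split => //; first by lra.
move=> d T P n p o bstar X theta xi Y l a delta mX _ mxi YE ind sp sX l2 _ _ nxi d0 d1.
have [L LE L0] : exists2 L, L = ln (1 / delta) & 0 < L.
  by exists (ln (1 / delta)) => //; rewrite ln_gt0// ltr_pdivlMr// mul1r.
rewrite -LE => nC.
have rate0 : 0 <= welsch_rate n p o l delta.
  by rewrite /welsch_rate !addr_ge0 ?mulr_ge0 ?powR_ge0 ?sqrtr_ge0.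
(* The summand [ln 6] of [W] is absorbed by [5 p], since [L] may be arbitrarily small; this needs
   [p >= 1]. For [p = 0] all vectors coincide. *)
have [p0|pp] := posnP p.
  exists setT; split => // [w _|]; last by rewrite probability_setT lee_fin; lra.
  have flat (u v : 'cV[R]_p) : u = v by apply/matrixP => i; have := ltn_ord i; rewrite [X
      in (_ < X)%N]p0.
  exists bstar; split; last by rewrite subrr enorm0 mulr_ge0//; lra.
  move=> it h val b; split => [_|_]; first exact: flat.
  split=> //; split => [|b' _]; last by rewrite (flat b b').
  by rewrite (flat b bstar) /basin/= subrr enorm0 ltW.
have p1 : (1 : R) <= p%:R by rewrite ler1n.
have /andP[il0 il2] := inv_exponent_bounds l2.
have [s [sM s1 cs]] := ball_net R p qgt0; rewrite -/Mn in sM.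
have l60 : 0 <= ln 6 :> R by rewrite ln_ge0//; lra.
have l62 : ln 6 <= 5 :> R by have := @le_ln1Dx R 5; rewrite (_ : 1 + 5 = 6); [apply; lra|lra].
(* Net entropy plus the level [ln (6 / delta)]: six events share the failure probability equally. *)
have [W WE] : exists W, W = Mn * p%:R + (L + ln 6) by eexists.
have W0 : 0 <= W by rewrite WE addr_ge0 ?mulr_ge0// addr_ge0// ltW.
have WQ : W <= M' * (p%:R + L).
  by rewrite WE M'E; have := mulr_ge0 Mn0 (ltW L0); lra.
have [[oLn o2 L2] [nW nW' no nL]] :=
  sample_size_bounds K1 M'1 kap0 ep0 L0 WQ C1_2 C1_K C1_kap C1_ep nC.
have np : (0 < n)%N.
  by rewrite -(@ltr_nat R); apply: lt_le_trans oLn; rewrite ltr_wpDl.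
pose tau : R := C * ((o%:R + L) / n%:R) `^ (2 * inv_exponent l).
have tau0 : 0 < tau by exact: tau_gt0.
have dL : expR (- L) = delta.
  by rewrite LE -lnV ?posrE ?divr_gt0// div1r invrK lnK.
have dE : expR (- (L + ln 6)) = delta / 6.
  by rewrite opprD expRD dL expRN lnK// posrE.
have la0 : 0 <= (512 * K)^-1 by rewrite invr_ge0; lra.
have exc t := @excess_event d T R P n p X mX sX K (HK d T P) s (Mn * p%:R) s1 sM t (L + ln 6).
have [BA [mBA PBA HBA]] := @lower_event d T R P n p X mX sX K (HK d T P) s (Mn * p%:R) s1 sM
  (512 * K)^-1 (L + ln 6) la0.
have [BE0 [mBE0 PBE0 HBE0]] := exc 0.
have [BE1 [mBE1 PBE1 HBE1]] := exc t1.
have [BE2 [mBE2 PBE2 HBE2]] := exc (4 * ln (n%:R / o%:R)).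
have [BC [mBC PBC HBC]] := @score_event d T R P n p X xi s (Mn * p%:R)
  (Num.sqrt ((p%:R + L) / n%:R)) tau (L + ln 6) mX mxi ind sX s1 sM.
have [BD [mBD PBD HBD]] := @clipped_noise_event d T R P n xi l a mxi nxi tau tau0 L np L0.
rewrite dE in PBA PBE0 PBE1 PBE2 PBC; rewrite dL in PBD.
have HB i : (i < 6)%N -> measurable (nth set0 [:: BA; BE0; BE1; BE2; BC; BD] i) /\
    (P (nth set0 [:: BA; BE0; BE1; BE2; BC; BD] i) <= (delta / 6%:R)%:E)%E.
  by case: i => [|[|[|[|[|[|]]]]]].
apply: (with_prob_ge_avoid _ HB sp) => // w /contrapT sparse avoid.
have nA : ~ BA w by exact: (avoid 0%N).
have nE0 : ~ BE0 w by exact: (avoid 1%N).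
have nE1 : ~ BE1 w by exact: (avoid 2%N).
have nE2 : ~ BE2 w by exact: (avoid 3%N).
have nCC : ~ BC w by exact: (avoid 4%N).
have nD : ~ BD w by exact: (avoid 5%N).
have qinv : 0 <= (q%:R)^-1 :> R by rewrite invr_ge0.
have [|t tE v vs|la v vs|bhat hb hd] := @good_event_conclusion R n p o (X w) (theta w) (xi w)
  bstar s q%:R^-1 c K W M' L C (inv_exponent l) ep t1 kap delta l np L0 C0 il0 il2 (ltW c0) c1 K1
  M'1 ep0 t10 W0 WQ cs qinv q4 qK kap0 kap502 t1K ept1 Cep oLn o2 L2 nW nW' no nL sparse
  _ _ _ (HBD w nD) erefl LE.
- by move=> la v vs; rewrite WE (addrA _ (Mn * p%:R)); exact: HBA.
- rewrite WE (addrA _ (Mn * p%:R)); move: tE; rewrite !inE => /or3P[/eqP ->|/eqP ->|/eqP ->].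
  + exact: HBE0.
  + exact: HBE1.
  + exact: HBE2.
- by rewrite WE (addrA _ (Mn * p%:R)); exact: HBC.
exists bhat; split; last first.
  by apply: (le_trans hd); rewrite -C2E ler_wpM2r.
move=> it h val b; rewrite /two_stage_output YE /welsch_tau -LE.
by split=> [[_ /hb]//|/hb bmin]; split => //; rewrite -YE.
Qed.
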